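(* There is an algorithm that, given an instance $(G,R,t,k)$ of Steiner Tree in which $G$ is an $n$-vertex clique-grid graph (given together with a representation $f$), $R\subseteq V(G)$ is a set of $t$ terminals and $k$ is a positive integer, decides whether $(G,R,t,k)$ is a yes-instance in time $n^{O(\sqrt{t+k})}$.
   Context: Steiner Tree: the input $(G,R,t,k)$ consists of a graph $G$ on $n$ vertices (unweighted), a set $R\subseteq V(G)$ with $|R|=t$ whose elements are called terminals, and a positive integer $k$. The question is whether there is a tree $T$ that is a subgraph of $G$ with $R\subseteq V(T)$ and $|V(T)\setminus R|\le k$. Write $[m]=\{1,\dots,m\}$. A graph $G$ is a clique-grid graph if there are $p,p'\in\mathbb{N}$ and a function $f:V(G)\to[p]\times[p']$ such that (1) for all $(i,j)\in[p]\times[p']$, $f^{-1}(i,j)$ is a clique in $G$; and (2) for all $uv\in E(G)$, if $f(u)=(i,j)$ and $f(v)=(i',j')$ then $|i-i'|\le 2$ and $|j-j'|\le 2$. Such an $f$ is called a representation of $G$. One may take $p,p'\le n$. *)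

(* Defs.v *)
From mathcomp Require Import all_boot.

Set Implicit Arguments.
Unset Strict Implicit.
Unset Printing Implicit Defensive.

(** * Graphs and Steiner trees *)

Record sgraph (V : finType) := SGraph {
  adj :> rel V;
  adj_sym : symmetric adj;
  adj_irr : irreflexive adj
}.

Definition clique (V : finType) (G : sgraph V) (S : {set V}) : Prop :=
  {in S &, forall u v, u != v -> G u v}.

(** A subgraph of [G] is a vertex set [W] with an adjacency relation [F]. *)
Definition is_subgraph (V : finType) (W : {set V}) (F : rel V)
    (G : sgraph V) : Prop :=
  forall x y, F x y -> [/\ x \in W, y \in W & G x y].

(** For a symmetric relation, [[:: x; y]] is a [ucycle] as soon as [x] and [y]
    are distinct and adjacent; genuine cycles have at least three vertices. *)
Definition acyclic (V : finType) (F : rel V) : Prop :=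
  forall c : seq V, ucycle F c -> size c <= 2.

Definition is_tree (V : finType) (W : {set V}) (F : rel V) : Prop :=
  [/\ symmetric F /\ irreflexive F,
      W != set0,
      {in W &, forall x y, connect F x y} &
      acyclic F].

Definition steiner_tree_yes (V : finType) (G : sgraph V) (R : {set V})
    (k : nat) : Prop :=
  exists (W : {set V}) (F : rel V),
    [/\ is_subgraph W F G, is_tree W F, R \subset W & #|W :\: R| <= k].

(** * Clique-grid graphs *)

(** [|i - j| <= 2], written without truncated subtraction. *)
Definition dist_le2 (i j : nat) : bool := (i <= j + 2) && (j <= i + 2).

(** The grid [p] x [p'] is indexed from 0 instead of 1. *)
Definition is_representation (V : finType) (G : sgraph V) (p p' : nat)
    (f : V -> 'I_p * 'I_p') : Prop :=
  (forall c : 'I_p * 'I_p', clique G [set u | f u == c]) /\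
  (forall u v, G u v ->
     dist_le2 (f u).1 (f v).1 /\ dist_le2 (f u).2 (f v).2).

(** * Model of computation

    First-order call-by-value recursive programs over binary trees (the data
    of pure Lisp).  Every evaluation rule costs one unit.  Values are only
    built, inspected at the root and copied by reference, and environments
    have length bounded by the program text, so each rule takes constant time
    on a random-access machine; conversely the model simulates Turing machines
    with polynomial overhead. *)

Inductive tree := Leaf | Node of tree & tree.

Inductive expr :=
| EVar of nat                    (* de Bruijn index *)
| ELeaf
| ENode of expr & expr
| ECase of expr & expr & expr    (* the last branch binds both subtrees:
                                    index 0 is the left one, 1 the right one *)
| ELet of expr & expr
| ECall of nat & expr.

(** The list of function bodies; each function has one argument, variable 0
    of its body.  The main function is number 0. *)
Definition program := seq expr.

Definition body (P : program) (i : nat) : expr := nth ELeaf P i.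

(** [eval P env e v m]: in environment [env] the expression [e] evaluates to
    [v] in time [m]. *)
Inductive eval (P : program) : seq tree -> expr -> tree -> nat -> Prop :=
| eval_var env i :
    eval P env (EVar i) (nth Leaf env i) 1
| eval_leaf env :
    eval P env ELeaf Leaf 1
| eval_node env e1 e2 v1 v2 m1 m2 :
    eval P env e1 v1 m1 -> eval P env e2 v2 m2 ->
    eval P env (ENode e1 e2) (Node v1 v2) (m1 + m2).+1
| eval_case_leaf env e e1 e2 v m m1 :
    eval P env e Leaf m -> eval P env e1 v m1 ->
    eval P env (ECase e e1 e2) v (m + m1).+1
| eval_case_node env e e1 e2 l r v m m2 :
    eval P env e (Node l r) m -> eval P (l :: r :: env) e2 v m2 ->
    eval P env (ECase e e1 e2) v (m + m2).+1
| eval_let env e1 e2 v1 v m1 m2 :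
    eval P env e1 v1 m1 -> eval P (v1 :: env) e2 v m2 ->
    eval P env (ELet e1 e2) v (m1 + m2).+1
| eval_call env i e a v m1 m2 :
    eval P env e a m1 -> eval P [:: a] (body P i) v m2 ->
    eval P env (ECall i e) v (m1 + m2).+1.

Definition runs (P : program) (input output : tree) (time : nat) : Prop :=
  eval P [:: input] (body P 0) output time.

(** Result and running time are unique, so that asserting the existence of a
    terminating run with some property describes the run. *)
Lemma runs_det (P : program) (x y y' : tree) (m m' : nat) :
  runs P x y m -> runs P x y' m' -> y = y' /\ m = m'.
Proof.
rewrite /runs => H; elim: H y' m' => {x y m}
  [env i|env|env e1 e2 v1 v2 m1 m2 _ IH1 _ IH2|env e e1 e2 v m m1 _ IH1 _ IH2
  |env e e1 e2 l r v m m2 _ IH1 _ IH2|env e1 e2 v1 v m1 m2 _ IH1 _ IH2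
  |env i e a v m1 m2 _ IH1 _ IH2] y' m' H; inversion H; subst => //;
  repeat match goal with
  | IH : forall y' m', eval ?P ?env ?e y' m' -> _, H : eval ?P ?env ?e _ _ |- _ =>
    case: (IH _ _ H) => ? ?; clear IH; subst; try discriminate
  | E : Node _ _ = Node _ _ |- _ => injection E => ? ?; clear E; subst
  end; by split.
Qed.

(** * Encoding of instances

    Numbers are written in unary.  The graph is its adjacency matrix, the
    terminal set its characteristic vector, the representation the list of
    its values. *)

Definition enc_bool (b : bool) : tree := if b then Node Leaf Leaf else Leaf.

Definition enc_nat (n : nat) : tree := iter n (Node Leaf) Leaf.

Definition enc_seq (s : seq tree) : tree := foldr Node Leaf s.

Definition enc_graph (n : nat) (G : sgraph 'I_n) : tree :=
  enc_seq [seq enc_seq [seq enc_bool (G u v) | v <- enum 'I_n]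
          | u <- enum 'I_n].

Definition enc_set (n : nat) (R : {set 'I_n}) : tree :=
  enc_seq [seq enc_bool (u \in R) | u <- enum 'I_n].

Definition enc_rep (n p p' : nat) (f : 'I_n -> 'I_p * 'I_p') : tree :=
  enc_seq [seq Node (enc_nat (f u).1) (enc_nat (f u).2) | u <- enum 'I_n].

Definition enc_instance (n : nat) (G : sgraph 'I_n) (R : {set 'I_n})
    (t k p p' : nat) (f : 'I_n -> 'I_p * 'I_p') : tree :=
  enc_seq [:: enc_nat n; enc_graph G; enc_set R; enc_nat t; enc_nat k;
              enc_nat p; enc_nat p'; enc_rep f].

(* Main.v *)
Require Import Defs.
From mathcomp Require Import all_boot all_order all_algebra.
From mathcomp Require Import reals exp.
From mathcomp Require Import zify lra.

Set Implicit Arguments.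
Unset Strict Implicit.
Unset Printing Implicit Defensive.

(** A solution may be taken to be a connected set [W] of at most [t + k] vertices
    containing [R].  Every cell is a clique, so [W] stays connected if, besides
    the terminals, only one representative per occupied cell and the end points
    of one edge per pair of linked cells are kept: at most 51 vertices per cell
    ([skeleton]).  With [s] the square root of [t + k] rounded up, some shift [r]
    makes the pairs of consecutive grid columns repeating with period [s] meet at
    most [2 s] occupied cells.  Keeping these cells and the parents of their
    vertices in memory throughout, one sweeps the remaining strips row by row;
    then only [O(s)] vertices have to be known at any time.

    Connectivity is certified locally: each kept vertex carries a depth, and one
    of positive depth has a neighbour of smaller depth; a terminal need only be
    equal or adjacent to a kept vertex.  The algorithm is thus a layered
    reachability search among the [n ^ O(s)] bags of (vertex, depth) pairs.

    The search is a function on ordinary data types.  Closure properties of the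
    functions computable in time polynomial in the size of the encoded argument
    provide the program, without it ever being written down. *)

(** * Depth functions and spanning trees *)

(** The witness is the length of a shortest walk to [rho]. The second vertex of a shortest walk is
    one step closer, which yields the parent. *)
Lemma depth_function (V : finType) (e : rel V) (rho : V) :
  exists d : V -> nat, d rho = 0 /\
    forall x, connect e x rho -> d x < #|V| /\
      (x = rho \/ exists y, [/\ e x y, connect e y rho & d x = (d y).+1]).
Proof.
pose walk x m := [exists s : m.-tuple V, path e x s && (last x s == rho)].
have walk0 : walk rho 0 by apply/existsP; exists [tuple]; rewrite /= eqxx.
(* When there is no walk, [find] returns [#|V|]; the value matters only for vertices connected to
   [rho]. *)
pose d x := find (walk x) (iota 0 #|V|).
have walk_connect x m : walk x m -> connect e x rho.
  by case/existsP=> s /andP[ps /eqP ls]; apply/connectP; exists s.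
have d_le x m : m < #|V| -> walk x m -> d x <= m.
  move=> mV wx; rewrite leqNgt; apply/negP => /(before_find 0).
  by rewrite nth_iota // add0n wx.
have d_walk x : connect e x rho -> d x < #|V| /\ walk x (d x).
  move=> cx; suff hx : has (walk x) (iota 0 #|V|).
    have := hx; rewrite has_find size_iota => dV; split=> //.
    by have := nth_find 0 hx; rewrite nth_iota.
  (* A duplicate-free path has fewer than [#|V|] steps, so the range searched is long enough. *)
  case/connectP: cx => s ps lx; case/shortenP: ps lx => s' ps' us' _ lx.
  apply/hasP; exists (size s').
    by rewrite mem_iota add0n /=; have := max_card (mem (x :: s'));
      rewrite (card_uniqP us').
  by apply/existsP; exists (in_tuple s'); rewrite /= ps' -lx eqxx.
have V0 : 0 < #|V| by apply/card_gt0P; exists rho.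
exists d; split; first by apply/eqP; rewrite -leqn0 d_le.
move=> x cx; have [dV wx] := d_walk x cx; split=> //.
case E : (d x) wx dV => [|m] wx dV.
  left; case/existsP: wx => s; rewrite tuple0 /= => /eqP //.
right; case/existsP: wx => s; case/tupleP: s => y s /= /andP[/andP[exy ps] ls].
have wy : walk y m by apply/existsP; exists s; rewrite ps.
exists y; split=> //; first exact: walk_connect wy.
have [dyV wdy] := d_walk y (walk_connect _ _ wy).
congr _.+1; apply/eqP; rewrite eqn_leq; apply/andP; split;
  last by apply: d_le => //; exact: ltnW.
rewrite -ltnS -E; have dym := d_le y m (ltnW dV) wy.
apply: d_le; first exact: (@leq_ltn_trans m.+1).
case/existsP: wdy => s' /andP[ps' ls']; apply/existsP; exists [tuple of y :: s'].
by rewrite /= exy ps' ls'.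
Qed.

Definition induced (V : finType) (G : rel V) (W : {set V}) : rel V :=
  fun x y => [&& x \in W, y \in W & G x y].

(** The tree joins each vertex other than [rho] to a parent whose depth is one less. *)
Lemma spanning_tree (V : finType) (G : sgraph V) (W : {set V}) (rho : V) :
  rho \in W -> (forall x, x \in W -> connect (induced G W) x rho) ->
  exists F : rel V, is_subgraph W F G /\ is_tree W F.
Proof.
move=> rW cW; have [d [d0 dP]] := depth_function (induced G W) rho.
pose par x := odflt rho [pick y | induced G W x y && (d x == (d y).+1)].
have parP x : x \in W -> x != rho -> [/\ par x \in W, G x (par x) & d x = (d (par
  x)).+1].
  move=> xW xr; have [_ [/eqP|[y [exy cy dx]]]] := dP x (cW x xW).
    by rewrite (negbTE xr).
  rewrite /par; case: pickP => [z /andP[/and3P[_ zW gxz] /eqP] //|/(_ y)].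
  by rewrite exy dx eqxx.
pose F : rel V := fun x y => [&& x \in W, y \in W &
   ((x != rho) && (par x == y)) || ((y != rho) && (par y == x))].
have symF : symmetric F by move=> x y; rewrite /F andbCA; congr [&& _, _ & _];
  rewrite orbC.
have subF x y : F x y -> [/\ x \in W, y \in W & G x y].
  case/and3P=> xW yW /orP[]/andP[nr /eqP <-]; split=> //.
  - by have [] := parP x xW nr.
  - by have [] := parP x xW nr.
  - by have [] := parP y yW nr.
  - by rewrite adj_sym; have [] := parP y yW nr.
have root m x : d x = m -> x \in W -> connect F x rho.
  elim: m x => [|m IH] x dx xW; have [->|nr] := eqVneq x rho => //.
    by have [_ _] := parP x xW nr; rewrite dx.
  have [pW gp dp] := parP x xW nr.
  apply: connect_trans (IH (par x) _ pW); last by apply: succn_inj; rewrite -dp.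
  by apply: connect1; rewrite /F xW pW nr eqxx.
exists F; split=> //; split.
- by split=> // x; apply/negP=> /subF[_ _]; rewrite adj_irr.
- by apply/set0Pn; exists rho.
- move=> x y xW yW; apply: connect_trans (root _ x erefl xW) _.
  by rewrite (sym_connect_sym symF) (root _ y erefl yW).
move=> c /andP[cyc uc]; rewrite leqNgt; apply/negP => c3.
have [x0 x0c] : exists x, x \in c by case: (c) c3 => // x ? _; exists x;
  apply: mem_head.
(* On a cycle, take a vertex of maximal depth. Neither neighbour can be its child, so both are its
   parent and coincide, which is impossible in a cycle of length at least 3. *)
pose x := [arg max_(y > x0 in c) d y].
have [xc xmax] : x \in c /\ forall y, y \in c -> d y <= d x.
  by rewrite /x; case: arg_maxnP.
have top y : y \in c -> F x y -> par x = y.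
  move=> yc /and3P[xW yW /orP[]/andP[nr /eqP]] // E.
  by have [_ _ dy] := parP y yW nr; have := xmax y yc; rewrite dy E ltnn.
have [i c' rc] := rot_to xc.
move: cyc uc c3; rewrite -(rot_cycle i) -(rot_uniq i) -(size_rot i c) rc.
have memc y : (y \in c) = (y \in x :: c') by rewrite -rc mem_rot.
case: c' rc memc => [|y [|z s]] rc memc //=.
rewrite rcons_path => /and3P[Fxy _ /andP[_ Fzx]] /and4P[_ yn _ _] _.
have py : par x = y by apply: top => //; rewrite memc !inE eqxx orbT.
have pz : par x = last z s.
  by apply: top; [rewrite memc 2!in_cons mem_last !orbT | rewrite symF].
by move: yn; rewrite -py pz mem_last.
Qed.

(** Removes the edge set from the problem: from here on a solution is a vertex set whose induced
    subgraph is connected. *)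
Lemma steiner_yesP (V : finType) (G : sgraph V) (R : {set V}) (k : nat) :
  steiner_tree_yes G R k <->
  exists W : {set V}, exists2 rho, rho \in W &
    [/\ forall x, x \in W -> connect (induced G W) x rho, R \subset W
      & #|W :\: R| <= k].
Proof.
split=> [[W [F [sF [_ /set0Pn[rho rW] cF _] RW kW]]]|[W [rho rW [cW RW kW]]]].
  exists W, rho => //; split=> // x xW.
  apply: (connect_sub _ (cF x rho xW rW)) => y z /sF[yW zW gyz].
  by apply: connect1; rewrite /induced yW zW.
by have [F [sF tF]] := spanning_tree rW cW; exists W, F.
Qed.

(** * Polynomial-time functions on encoded data *)

Class Enc (T : Type) := enc : T -> tree.
#[global] Instance Enc_unit : Enc unit := fun _ => Leaf.
#[global] Instance Enc_bool : Enc bool := enc_bool.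
#[global] Instance Enc_nat : Enc nat := enc_nat.
#[global] Instance Enc_prod A B {EA : Enc A} {EB : Enc B} : Enc (A * B) :=
  fun x => Node (enc x.1) (enc x.2).
#[global] Instance Enc_seq A {EA : Enc A} : Enc (seq A) :=
  fun s => enc_seq (map enc s).

Fixpoint tsize (x : tree) : nat :=
  if x is Node l r then (tsize l + tsize r).+1 else 1.

(** The successor makes this measure exactly additive on pairs and on [cons], and keeps it at least
    2. *)
Definition esize (A : Type) {EA : Enc A} (a : A) : nat := (tsize (enc a)).+1.
Arguments esize {A EA} a.

Lemma leq_expl (d m n : nat) : m <= n -> m ^ d <= n ^ d.
Proof. by case: d => // d; rewrite leq_exp2r. Qed.

(** * Bounds by a power of a size measure; as the measure is at least 2, constants are absorbed by
    the exponent *)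

Definition pbounded (A : Type) (mu T : A -> nat) : Prop :=
  exists d, forall a, T a <= mu a ^ d.

Section PBounded.
Variables (A : Type) (mu : A -> nat).
Hypothesis mu2 : forall a, 1 < mu a.

Lemma pbounded_le (T U : A -> nat) :
  (forall a, T a <= U a) -> pbounded mu U -> pbounded mu T.
Proof. by move=> le [d Ud]; exists d => a; apply: leq_trans (le a) (Ud a). Qed.

Lemma pbounded_const (c : nat) : pbounded mu (fun=> c).
Proof.
exists c => a; apply: leq_trans (ltnW (ltn_expl c (isT : 1 < 2))) _.
by case: c => // c; rewrite leq_exp2r.
Qed.

Lemma pbounded_mul (T U : A -> nat) :
  pbounded mu T -> pbounded mu U -> pbounded mu (fun a => T a * U a).
Proof. by move=> [d Td] [e Ue]; exists (d + e) => a; rewrite expnD leq_mul. Qed.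

Lemma pbounded_exp (T : A -> nat) (e : nat) :
  pbounded mu T -> pbounded mu (fun a => T a ^ e).
Proof.
by move=> [d Td]; exists (d * e) => a; rewrite expnM leq_expl.
Qed.

Lemma pbounded_add (T U : A -> nat) :
  pbounded mu T -> pbounded mu U -> pbounded mu (fun a => T a + U a).
Proof.
move=> [d Td] [e Ue]; exists (maxn d e).+1 => a.
have mu0 : 0 < mu a by apply: ltnW.
apply: (@leq_trans (2 * mu a ^ maxn d e)); last by rewrite expnS leq_mul.
rewrite mul2n -addnn leq_add //.
  by apply: leq_trans (Td a) _; rewrite leq_pexp2l ?leq_maxl.
by apply: leq_trans (Ue a) _; rewrite leq_pexp2l ?leq_maxr.
Qed.

Lemma pbounded_succ (T : A -> nat) :
  pbounded mu T -> pbounded mu (fun a => (T a).+1).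
Proof.
move=> pT; apply: (@pbounded_le _ (fun a => T a + 1)).
  by move=> a; rewrite addn1.
by apply: pbounded_add => //; apply: pbounded_const.
Qed.

Lemma pbounded_comp (B : Type) (g : A -> B) (nu T : B -> nat) :
  pbounded mu (fun a => nu (g a)) -> pbounded nu T ->
  pbounded mu (fun a => T (g a)).
Proof.
move=> pg [e Te]; apply: pbounded_le (pbounded_exp e pg) => a; exact: Te.
Qed.

Lemma pbounded_refl : pbounded mu mu.
Proof. by exists 1 => a; rewrite expn1. Qed.

End PBounded.

(** * Functions with code of bounded running time *)

Definition has_fun (A B : Type) {EA : Enc A} {EB : Enc B} (P : program)
    (i : nat) (f : A -> B) (T : A -> nat) : Prop :=
  forall a, exists2 m, m <= T a & eval P [:: enc a] (body P i) (enc (f a)) m.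
Arguments has_fun {A B EA EB} P i f T.

(** The code of [f] can be placed at any offset of any larger program. *)
Definition codable (A B : Type) {EA : Enc A} {EB : Enc B} (mu : A -> nat)
    (f : A -> B) : Prop :=
  forall n0, exists Q i, exists2 T, pbounded mu T &
    forall P0 P1, size P0 = n0 -> has_fun (P0 ++ Q ++ P1) i f T.
Arguments codable {A B EA EB} mu f.

(** Output sizes are bounded separately: values are shared when copied, so a
    program can build a tree exponentially larger than its running time. *)
Definition ptime_wrt (A B : Type) {EA : Enc A} {EB : Enc B} (mu : A -> nat)
    (f : A -> B) : Prop :=
  codable mu f /\ pbounded mu (fun a => esize (f a)).
Arguments ptime_wrt {A B EA EB} mu f.

Notation ptime f := (ptime_wrt esize f).

Lemma esize_gt1 (A : Type) {EA : Enc A} (a : A) : 1 < esize a.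
Proof. by rewrite /esize; case: (enc a). Qed.
#[global] Hint Resolve esize_gt1 : core.

Ltac pbase := first [assumption | exact: esize_gt1].

Ltac pbound :=
  first [assumption | exact: pbounded_refl |
  lazymatch goal with
  | |- pbounded _ (fun a => _ + _) => apply: pbounded_add;
    [pbase | pbound | pbound]
  | |- pbounded _ (fun a => _ * _) => apply: pbounded_mul; pbound
  | |- pbounded _ (fun a => _ ^ _) => apply: pbounded_exp; pbound
  | |- pbounded _ (fun a => S _) => apply: pbounded_succ; [pbase | pbound]
  | |- pbounded _ (fun a => _) => apply: pbounded_const; pbase
  end].

Lemma esize_pair (A B : Type) {EA : Enc A} {EB : Enc B} (x : A * B) :
  esize x = esize x.1 + esize x.2.
Proof. by rewrite /esize /= addnS addSn. Qed.

Lemma esize_cons (A : Type) {EA : Enc A} (a : A) (s : seq A) :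
  esize (a :: s) = esize a + esize s.
Proof. exact: (esize_pair (a, s)). Qed.

Lemma esize_nat (n : nat) : esize n = 2 * n.+1.
Proof.
rewrite /esize; elim: n => // n IH;
  rewrite /enc /Enc_nat /enc_nat /= -/(enc_nat n).
by rewrite -/(enc n) add1n mulnS -IH.
Qed.

Lemma esize_bool (b : bool) : esize b <= 4.
Proof. by case: b. Qed.

Lemma esize_cat (A : Type) {EA : Enc A} (s s' : seq A) :
  esize (s ++ s') + 2 = esize s + esize s'.
Proof.
by elim: s => [|a s IH]; rewrite ?cat_cons ?esize_cons -?addnA ?IH 1?addnC.
Qed.

Lemma size_leq_esize (A : Type) {EA : Enc A} (s : seq A) :
  2 * (size s).+1 <= esize s.
Proof.
elim: s => // a s IH; rewrite esize_cons mulnS leq_add //; exact: esize_gt1.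
Qed.

Section Codable.
Variables (A1 B1 A2 B2 A3 B3 A B : Type).
Context {EA1 : Enc A1} {EB1 : Enc B1} {EA2 : Enc A2} {EB2 : Enc B2}.
Context {EA3 : Enc A3} {EB3 : Enc B3} {EA : Enc A} {EB : Enc B}.
Variables (mu1 : A1 -> nat) (mu2 : A2 -> nat) (mu3 : A3 -> nat) (mu : A -> nat).

(** Linking: the codes of three auxiliary functions are laid out one after another, followed by the
    new bodies [bs] at offset [l]. Three is the most that a combinator below calls; those calling
    fewer repeat an argument. *)
Lemma codable_bodies (f1 : A1 -> B1) (f2 : A2 -> B2) (f3 : A3 -> B3)
    (g : A -> B) :
  codable mu1 f1 -> codable mu2 f2 -> codable mu3 f3 ->
  (forall i1 i2 i3 l T1 T2 T3, pbounded mu1 T1 -> pbounded mu2 T2 ->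
     pbounded mu3 T3 ->
     exists bs, exists2 T, pbounded mu T & forall P,
       has_fun P i1 f1 T1 -> has_fun P i2 f2 T2 -> has_fun P i3 f3 T3 ->
       (forall j, j < size bs -> body P (l + j) = nth ELeaf bs j) ->
       has_fun P l g T) ->
  codable mu g.
Proof.
move=> c1 c2 c3 cg n0.
have [Q1 [i1 [T1 pT1 h1]]] := c1 n0.
have [Q2 [i2 [T2 pT2 h2]]] := c2 (n0 + size Q1).
have [Q3 [i3 [T3 pT3 h3]]] := c3 (n0 + size Q1 + size Q2).
pose l := n0 + size Q1 + size Q2 + size Q3.
have [bs [T pT hg]] := cg i1 i2 i3 l T1 T2 T3 pT1 pT2 pT3.
exists (Q1 ++ Q2 ++ Q3 ++ bs), l; exists T => // P0 P1 sP0.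
apply: hg.
- by rewrite -!catA; apply: h1.
- rewrite -!catA.
  have -> : P0 ++ Q1 ++ Q2 ++ Q3 ++ bs ++ P1 = (P0 ++ Q1) ++ Q2 ++ Q3 ++ bs ++ P1.
    by rewrite -!catA.
  by apply: h2; rewrite size_cat sP0.
- have -> : P0 ++ (Q1 ++ Q2 ++ Q3 ++ bs) ++ P1 =
      (P0 ++ Q1 ++ Q2) ++ Q3 ++ (bs ++ P1).
    by rewrite -!catA.
  by apply: h3; rewrite !size_cat sP0 addnA.
- move=> j jb; rewrite /body.
  have -> : P0 ++ (Q1 ++ Q2 ++ Q3 ++ bs) ++ P1 =
      (P0 ++ Q1 ++ Q2 ++ Q3) ++ bs ++ P1.
    by rewrite -!catA.
  rewrite nth_cat !size_cat sP0 !addnA -/l ltnNge leq_addr /= addnC addnK.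
  by rewrite nth_cat jb.
Qed.

End Codable.

Lemma codable_expr (A B : Type) {EA : Enc A} {EB : Enc B} (mu T : A -> nat)
    (f : A -> B) (b : expr) :
  pbounded mu T ->
  (forall P a, exists2 m, m <= T a & eval P [:: enc a] b (enc (f a)) m) ->
  codable mu f.
Proof.
move=> pT hb n0; exists [:: b], n0; exists T => // P0 P1 sP0 a.
by rewrite /body nth_cat sP0 ltnn subnn; apply: hb.
Qed.

Section Combinators.
Variables (A : Type).
Context {EA : Enc A}.
Variable (mu : A -> nat).
Hypothesis mu2 : forall a, 1 < mu a.

Lemma ptime_id_wrt : pbounded mu esize -> ptime_wrt mu (@id A).
Proof.
move=> pmu; split=> //.
apply: (@codable_expr _ _ _ _ mu (fun=> 1) _ (EVar 0)); first by pbound.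
by move=> P a; exists 1 => //; apply: eval_var.
Qed.

Fixpoint quote (x : tree) : expr :=
  if x is Node l r then ENode (quote l) (quote r) else ELeaf.

Lemma eval_quote P env x : eval P env (quote x) x (tsize x).
Proof.
by elim: x => [|l IHl r IHr] /=; [apply: eval_leaf | apply: eval_node].
Qed.

Lemma ptime_const_wrt (B : Type) {EB : Enc B} (b : B) :
  ptime_wrt mu (fun=> b : B).
Proof.
split; last by pbound.
apply: (@codable_expr _ _ _ _ mu (fun=> tsize (enc b)) _ (quote (enc b))).
  by pbound.
by move=> P a; exists (tsize (enc b)) => //; apply: eval_quote.
Qed.

(** Programs see only encodings, so values of different types with equal encodings are
    interchangeable: a pair and a [cons], a number and a list of [unit], a boolean and a list of
    length at most one. *)
Lemma ptime_recode_wrt (B B' : Type) {EB : Enc B} {EB' : Enc B'}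
    (f : A -> B) (g : A -> B') :
  (forall a, enc (f a) = enc (g a)) -> ptime_wrt mu g -> ptime_wrt mu f.
Proof.
move=> fg [cg [d sg]]; split; last by exists d => a; rewrite /esize fg; apply: sg.
move=> n0; have [Q [i [T pT h]]] := cg n0; exists Q, i; exists T => //.
by move=> P0 P1 sP0 a; rewrite fg; apply: h.
Qed.

(** The running time of [f] is a power of the size of [g a]; the output-size half of [ptime_wrt] for
    [g] turns it into a power of [mu a]. *)
Lemma ptime_comp_wrt (B C : Type) {EB : Enc B} {EC : Enc C}
    (f : B -> C) (g : A -> B) :
  ptime f -> ptime_wrt mu g -> ptime_wrt mu (fun a => f (g a)).
Proof.
move=> [cf sf] [cg sg]; split; last exact: (pbounded_comp sg sf).
apply: (codable_bodies cf cg cg) => i j i3 l Tf Tg T3 pf pg p3.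
exists [:: ECall i (ECall j (EVar 0))].
exists (fun a => ((1 + Tg a).+1 + Tf (g a)).+1).
  by have := pbounded_comp sg pf => ?; pbound.
move=> P hf hg _ hb a; have := hb 0 isT; rewrite addn0 /= => ->.
have [m1 m1T e1] := hg a; have [m2 m2T e2] := hf (g a).
exists ((1 + m1).+1 + m2).+1; first by rewrite !ltnS leq_add // ltnS leq_add2l.
by apply: eval_call e2; apply: eval_call e1; apply: eval_var.
Qed.

Lemma ptime_pair_wrt (B C : Type) {EB : Enc B} {EC : Enc C}
    (f : A -> B) (g : A -> C) :
  ptime_wrt mu f -> ptime_wrt mu g -> ptime_wrt mu (fun a => (f a, g a)).
Proof.
move=> [cf sf] [cg sg]; split; last first.
  apply: (@pbounded_le _ _ _ (fun a => esize (f a) + esize (g a)));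
    last by pbound.
  by move=> a; rewrite esize_pair.
apply: (codable_bodies cf cg cg) => i j i3 l Tf Tg T3 pf pg p3.
exists [:: ENode (ECall i (EVar 0)) (ECall j (EVar 0))].
exists (fun a => ((1 + Tf a).+1 + (1 + Tg a).+1).+1); first by pbound.
move=> P hf hg _ hb a; have := hb 0 isT; rewrite addn0 /= => ->.
have [m1 m1T e1] := hf a; have [m2 m2T e2] := hg a.
exists ((1 + m1).+1 + (1 + m2).+1).+1; first by lia.
by apply: eval_node; [apply: eval_call e1|apply: eval_call e2]; apply: eval_var.
Qed.

Lemma ptime_caseseq_wrt (H B : Type) {EH : Enc H} {EB : Enc B}
    (s : A -> seq H) (b : A -> B) (f : A -> H -> seq H -> B) :
  pbounded mu esize ->
  ptime_wrt mu s -> ptime_wrt mu b ->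
  ptime (fun y : H * (seq H * A) => f y.2.2 y.1 y.2.1) ->
  ptime_wrt mu (fun a => if s a is x :: s' then f a x s' else b a).
Proof.
move=> pe [cs ss] [cb sb] [cf sf].
have pg (T : H * (seq H * A) -> nat) : pbounded esize T ->
   pbounded mu (fun a => if s a is x :: s' then T (x, (s', a)) else 0).
  move=> [d Td].
  apply: (@pbounded_le _ _ _ (fun a => (esize (s a) + esize a) ^ d)).
    move=> a; case E: (s a) => [|x s'] //.
    apply: leq_trans (Td _) _; apply: leq_expl.
    by rewrite !esize_pair esize_cons addnA.
  by pbound.
split; last first.
  apply: (@pbounded_le _ _ _ (fun a => esize (b a) +
     if s a is x :: s' then esize (f a x s') else 0)).
    by move=> a; case: (s a) => [|x s']; rewrite ?addn0 ?leq_addl.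
  apply: pbounded_add => //; exact: (pg _ sf).
apply: (codable_bodies cs cb cf) => i j k l Ts Tb Tf ps pb pf.
exists [:: ECase (ECall i (EVar 0)) (ECall j (EVar 0))
   (ECall k (ENode (EVar 0) (ENode (EVar 1) (EVar 2))))].
exists (fun a => Ts a + Tb a + 20 + if s a is x :: s' then Tf (x, (s', a)) else
  0).
  by have := pg _ pf => ?; pbound.
move=> P hs hb hf /(_ 0 isT) + a; rewrite addn0 /= => ->.
have [m1 m1T e1] := hs a.
move: e1; case E: (s a) => [|x s'] e1.
  have [m2 m2T e2] := hb a.
  exists ((1 + m1).+1 + (1 + m2).+1).+1; first by lia.
  apply: eval_case_leaf; first by apply: eval_call e1; apply: eval_var.
  by apply: eval_call e2; apply: eval_var.
have [m2 m2T e2] := hf (x, (s', a)).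
exists ((1 + m1).+1 + ((1 + (1 + 1).+1).+1 + m2).+1).+1.
  by move: m2T; lia.
apply: eval_case_node; first by apply: eval_call e1; apply: eval_var.
apply: eval_call e2; apply: eval_node; first exact: eval_var.
by apply: eval_node; apply: eval_var.
Qed.

(** The bound [U] on every intermediate accumulator is what keeps the loop polynomial: a polynomial
    step alone could let sizes grow exponentially under iteration. *)
Lemma ptime_foldl_wrt (H B : Type) {EH : Enc H} {EB : Enc B}
    (s : A -> seq H) (b : A -> B) (f : A -> B -> H -> B) (U : A -> nat) :
  pbounded mu esize ->
  ptime_wrt mu s -> ptime_wrt mu b ->
  ptime (fun y : H * (B * A) => f y.2.2 y.2.1 y.1) ->
  pbounded mu U ->
  (forall a s1 s2, s a = s1 ++ s2 -> esize (foldl (f a) (b a) s1) <= U a) ->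
  ptime_wrt mu (fun a => foldl (f a) (b a) (s a)).
Proof.
move=> pe [cs ss] [cb sb] [cf sf] pU Ub; split; last first.
  by apply: pbounded_le pU => a; apply: (Ub a _ [::]); rewrite cats0.
apply: (codable_bodies cs cb cf) => i j k l Ts Tb Tf ps pb [d pf].
pose loop := l.+1.
(* Time for one round of the loop: one call of the step function, plus a constant. *)
pose (X := fun a : A => (esize (s a) + U a + esize a) ^ d + 20).
(* The first body starts the loop on the triple (list, accumulator, [a]). In the second, after three
   case distinctions, variables 0 to 3 are head, tail, accumulator and [a]. *)
exists [:: ECall loop (ENode (ECall i (EVar 0)) (ENode (ECall j (EVar 0)) (EVar
  0)));
  ECase (EVar 0) ELeaf (ECase (EVar 1) ELeaf (ECase (EVar 2) (EVar 0)
    (ECall loop (ENode (EVar 1) (ENode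
       (ECall k (ENode (EVar 0) (ENode (EVar 2) (EVar 3)))) (EVar 3))))))].
exists (fun a => Ts a + Tb a + 20 + (esize (s a)) * X a).
  by rewrite /X; pbound.
move=> P hs hb hf hbs a; have := hbs 0 isT; rewrite addn0 /= => ->.
have bloop := hbs 1 isT; rewrite addn1 -/loop in bloop.
have eloop s1 s2 : s a = s1 ++ s2 ->
    exists2 m, m <= (size s2).+1 * X a &
    eval P [:: Node (enc s2) (Node (enc (foldl (f a) (b a) s1)) (enc a))]
      (body P loop) (enc (foldl (f a) (b a) (s a))) m.
  elim: s2 s1 => [|h s2 IH] s1 E.
    exists (1 + (1 + (1 + 1).+1).+1).+1; first by rewrite /X; lia.
    have -> : s1 = s a by rewrite E cats0.
    rewrite bloop /=; apply: eval_case_node; first exact: eval_var.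
    apply: eval_case_node; first exact: eval_var.
    by apply: eval_case_leaf; apply: eval_var.
  have E' : s a = rcons s1 h ++ s2 by rewrite cat_rcons.
  have [m mT em] := IH _ E'.
  have [m' m'T em'] := hf (h, (foldl (f a) (b a) s1, a)).
  have {pf}m'X : m' <= (esize (s a) + U a + esize a) ^ d.
    apply: leq_trans m'T _; apply: leq_trans (pf _) _.
    apply: leq_expl.
    have := Ub a _ _ E; have := @esize_cat _ EH s1 (h :: s2);
    have := @esize_gt1 _ (@Enc_seq _ EH) s1.
    by rewrite -E !esize_pair esize_cons /=; lia.
  exists (1 + (1 + (1 + ((1 + (((1 + (1 + 1).+1).+1 + m').+1 + 1).+1).+1 +
    m).+1).+1).+1).+1.
    by move: mT; rewrite [(size (h :: s2)).+1 * _]mulSn /= {2}/X; lia.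
  rewrite bloop /=; apply: eval_case_node; first exact: eval_var.
  apply: eval_case_node; first exact: eval_var.
  apply: eval_case_node; first exact: eval_var.
  apply: eval_call; last first.
    exact: em.
  apply: eval_node; first exact: eval_var.
  apply: eval_node; last exact: eval_var.
  rewrite foldl_rcons; apply: eval_call; last exact: em'.
  by apply: eval_node; [|apply: eval_node]; apply: eval_var.
have [m1 m1T e1] := hs a; have [m2 m2T e2] := hb a.
have [m3 m3T e3] := eloop [::] (s a) erefl.
exists (((1 + m1).+1 + ((1 + m2).+1 + 1).+1).+1 + m3).+1.
  have : m3 <= esize (s a) * X a.
    apply: leq_trans m3T _; rewrite leq_mul2r; apply/orP; right.
    by have := @size_leq_esize _ EH (s a); lia.
  by lia.
apply: eval_call e3.
apply: eval_node; first by apply: eval_call e1; apply: eval_var.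
by apply: eval_node; [apply: eval_call e2|]; apply: eval_var.
Qed.

End Combinators.

Section Basics.
Variables (A : Type).
Context {EA : Enc A}.

Let e2 := @esize_gt1 A EA.
Let pe : pbounded (@esize A EA) esize := pbounded_refl _.

Lemma ptime_id : ptime (fun a : A => a).
Proof. exact: ptime_id_wrt. Qed.

Lemma ptime_const (B : Type) {EB : Enc B} (b : B) : ptime (fun _ : A => b).
Proof. exact: ptime_const_wrt. Qed.

Lemma ptime_recode (B B' : Type) {EB : Enc B} {EB' : Enc B'}
    (f : A -> B) (g : A -> B') :
  (forall a, enc (f a) = enc (g a)) -> ptime g -> ptime f.
Proof. exact: ptime_recode_wrt. Qed.

Lemma ptime_pair (B C : Type) {EB : Enc B} {EC : Enc C}
    (f : A -> B) (g : A -> C) :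
  ptime f -> ptime g -> ptime (fun a => (f a, g a)).
Proof. exact: ptime_pair_wrt. Qed.

Lemma ptime_comp (B C : Type) {EB : Enc B} {EC : Enc C}
    (f : B -> C) (g : A -> B) :
  ptime f -> ptime g -> ptime (fun a => f (g a)).
Proof. exact: ptime_comp_wrt. Qed.

Lemma ptime_fst (B C : Type) {EB : Enc B} {EC : Enc C} (f : A -> B * C) :
  ptime f -> ptime (fun a => (f a).1).
Proof.
apply: ptime_comp_wrt => //; split.
  apply: (@codable_expr _ _ _ _ _ (fun=> 3) _ (ECase (EVar 0) ELeaf (EVar 0))).
    exact: pbounded_const.
  move=> P a; exists (1 + 1).+1 => //.
  by apply: eval_case_node; apply: eval_var.
apply: pbounded_le (pbounded_refl _) => a.
by rewrite esize_pair leq_addr.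
Qed.

Lemma ptime_snd (B C : Type) {EB : Enc B} {EC : Enc C} (f : A -> B * C) :
  ptime f -> ptime (fun a => (f a).2).
Proof.
apply: ptime_comp_wrt => //; split.
  apply: (@codable_expr _ _ _ _ _ (fun=> 3) _ (ECase (EVar 0) ELeaf (EVar 1))).
    exact: pbounded_const.
  move=> P a; exists (1 + 1).+1 => //.
  by apply: eval_case_node; apply: eval_var.
apply: pbounded_le (pbounded_refl _) => a.
by rewrite esize_pair leq_addl.
Qed.

Lemma ptime_cons (B : Type) {EB : Enc B} (f : A -> B) (s : A -> seq B) :
  ptime f -> ptime s -> ptime (fun a => f a :: s a).
Proof.
move=> pf ps; apply: (@ptime_recode _ _ _ _ _ (fun a => (f a, s a))) => //.
exact: ptime_pair.
Qed.

Lemma ptime_succ (n : A -> nat) : ptime n -> ptime (fun a => (n a).+1).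
Proof.
move=> pn; apply: (@ptime_recode _ _ _ _ _ (fun a => (tt, n a))) => //.
by apply: ptime_pair => //; apply: ptime_const.
Qed.

Lemma ptime_caseseq (H B : Type) {EH : Enc H} {EB : Enc B}
    (s : A -> seq H) (b : A -> B) (f : A -> H -> seq H -> B) :
  ptime s -> ptime b -> ptime (fun y : H * (seq H * A) => f y.2.2 y.1 y.2.1) ->
  ptime (fun a => if s a is x :: s' then f a x s' else b a).
Proof. exact: ptime_caseseq_wrt. Qed.

End Basics.

Ltac ptime_proj :=
  lazymatch goal with
  | |- ptime_wrt _ (fun a => fst _) => apply: ptime_fst; ptime_proj
  | |- ptime_wrt _ (fun a => snd _) => apply: ptime_snd; ptime_proj
  | |- ptime_wrt _ (fun a => pair _ _) => apply: ptime_pair; ptime_proj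
  | |- ptime_wrt _ fst => apply: ptime_fst; exact: ptime_id
  | |- ptime_wrt _ snd => apply: ptime_snd; exact: ptime_id
  | |- ptime_wrt _ (fun a => a) => exact: ptime_id
  | |- _ => first [exact: ptime_const | assumption]
  end.

Ltac ptime_pre H g := apply: (@ptime_comp _ _ _ _ _ _ _ g H); ptime_proj.

Lemma enc_unary (n : nat) : enc n = enc (nseq n tt).
Proof. by elim: n => // n IH; congr (Node Leaf _). Qed.

Section ControlFlow.
Variables (A : Type).
Context {EA : Enc A}.

Let pe : pbounded (@esize A EA) esize := pbounded_refl _.

Lemma ptime_if (B : Type) {EB : Enc B} (c : A -> bool) (f g : A -> B) :
  ptime c -> ptime f -> ptime g -> ptime (fun a => if c a then f a else g a).
Proof.
move=> pc pf pg.
apply: (@ptime_recode _ _ _ _ _ _ _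
  (fun a => if nseq (c a) tt is x :: s' then f a else g a)).
  by move=> a; case: (c a).
apply: (@ptime_caseseq _ _ unit _ _ _ (fun a => nseq (c a) tt) g (fun a _ _ => f
  a)) => //.
  by apply: ptime_recode pc => a; case: (c a).
by ptime_pre pf (fun y : unit * (seq unit * A) => y.2.2).
Qed.

Lemma ptime_casenat (B : Type) {EB : Enc B}
    (n : A -> nat) (b : A -> B) (f : A -> nat -> B) :
  ptime n -> ptime b -> ptime (fun y : nat * A => f y.2 y.1) ->
  ptime (fun a => if n a is n'.+1 then f a n' else b a).
Proof.
move=> pn pb pf.
apply: (@ptime_recode _ _ _ _ _ _ _
  (fun a => if nseq (n a) tt is x :: s' then f a (size s') else b a)).
  by move=> a; case: (n a) => //= n'; rewrite size_nseq.
apply: (@ptime_caseseq _ _ unit _ _ _ (fun a => nseq (n a) tt) b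
  (fun a _ s' => f a (size s'))) => //.
  by apply: ptime_recode pn => a; rewrite -enc_unary.
apply: (@ptime_comp _ _ _ _ _ _ _ (fun y : unit * (seq unit * A) => (size y.2.1,
  y.2.2)) pf).
apply: ptime_pair; last by ptime_proj.
apply: (@ptime_recode _ _ _ _ _ _ _ (fun y : unit * (seq unit * A) => y.2.1));
  last by ptime_proj.
by case=> u [s a] /=; rewrite enc_unary; congr (enc _); elim: s => //= -[] s ->.
Qed.

Lemma ptime_foldl (H B : Type) {EH : Enc H} {EB : Enc B}
    (s : A -> seq H) (b : A -> B) (f : A -> B -> H -> B) (U : A -> nat) :
  ptime s -> ptime b ->
  ptime (fun y : H * (B * A) => f y.2.2 y.2.1 y.1) ->
  pbounded esize U ->
  (forall a s1 s2, s a = s1 ++ s2 -> esize (foldl (f a) (b a) s1) <= U a) ->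
  ptime (fun a => foldl (f a) (b a) (s a)).
Proof. exact: ptime_foldl_wrt. Qed.

Lemma ptime_rev (H : Type) {EH : Enc H} (s : A -> seq H) :
  ptime s -> ptime (fun a => rev (s a)).
Proof.
move=> ps; have [_ ss] := ps.
apply: (@ptime_recode _ _ _ _ _ _ _ (fun a => foldl (fun acc x => x :: acc) [::]
  (s a))).
  move=> a; congr (enc _); rewrite -[LHS]cats0 /rev -catrevE.
  by elim: (s a) [::] => //= x s' IH s1; rewrite IH.
apply: (@ptime_foldl _ _ _ _ s (fun=> [::]) (fun a acc x => x :: acc) _ ps) ss _.
- exact: ptime_const.
- by apply: ptime_cons; ptime_proj.
- move=> a s1 s2 ->.
  have le (s0 : seq H) : esize (foldl (fun acc x => x :: acc) s0 s1) <=
      esize s0 + esize (s1 ++ s2) - 2.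
    elim: s1 s0 => [|x s1 IH] s0 /=.
      by have := @size_leq_esize _ EH s2; lia.
    by apply: leq_trans (IH _) _; rewrite !esize_cons; lia.
  by apply: leq_trans (le _) _; have -> : esize ([::] : seq H) = 2 by [];
    rewrite addKn.
Qed.

End ControlFlow.

Section Folds.
Variables (A : Type).
Context {EA : Enc A}.

(** A left fold over the reversed list; its accumulators are the right folds over suffixes, hence
    the form of the size hypothesis. *)
Lemma ptime_foldr (H B : Type) {EH : Enc H} {EB : Enc B}
    (s : A -> seq H) (b : A -> B) (f : A -> H -> B -> B) (U : A -> nat) :
  ptime s -> ptime b ->
  ptime (fun y : H * (B * A) => f y.2.2 y.1 y.2.1) ->
  pbounded esize U ->
  (forall a s1 s2, s a = s1 ++ s2 -> esize (foldr (f a) (b a) s2) <= U a) ->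
  ptime (fun a => foldr (f a) (b a) (s a)).
Proof.
move=> ps pb pf pU Ub.
apply: (@ptime_recode _ _ _ _ _ _ _
  (fun a => foldl (fun z x => f a x z) (b a) (rev (s a)))).
  by move=> a; rewrite foldl_rev.
apply: (@ptime_foldl _ _ _ _ _ _ (fun a => rev (s a)) b (fun a z x => f a x z) U)
  => //.
  exact: ptime_rev.
move=> a s1 s2 E; rewrite -[s1]revK foldl_rev; apply: (Ub _ (rev s2)).
by rewrite -rev_cat -E revK.
Qed.

Lemma ptime_iter (B : Type) {EB : Enc B}
    (n : A -> nat) (b : A -> B) (f : A -> B -> B) (U : A -> nat) :
  ptime n -> ptime b -> ptime (fun y : B * A => f y.2 y.1) ->
  pbounded esize U ->
  (forall a i, i <= n a -> esize (iter i (f a) (b a)) <= U a) ->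
  ptime (fun a => iter (n a) (f a) (b a)).
Proof.
move=> pn pb pf pU Ub.
have fI a s : foldr (fun (_ : unit) => f a) (b a) s = iter (size s) (f a) (b a).
  by elim: s => //= _ s ->.
apply: (@ptime_recode _ _ _ _ _ _ _
  (fun a => foldr (fun _ => f a) (b a) (nseq (n a) tt))).
  by move=> a; rewrite fI size_nseq.
apply: (@ptime_foldr _ _ _ _ (fun a => nseq (n a) tt) b (fun a _ => f a) U) => //.
- by apply: ptime_recode pn => a; rewrite -enc_unary.
- by ptime_pre pf (fun y : unit * (B * A) => y.2).
- move=> a s1 s2 /(congr1 size); rewrite size_nseq size_cat fI => E.
  by apply: Ub; rewrite E leq_addl.
Qed.

Lemma ptime_map (H B : Type) {EH : Enc H} {EB : Enc B}
    (s : A -> seq H) (f : A -> H -> B) :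
  ptime (fun y : H * A => f y.2 y.1) -> ptime s ->
  ptime (fun a => [seq f a x | x <- s a]).
Proof.
move=> pf ps; have [_ [d fd]] := pf; have [_ ss] := ps.
apply: (@ptime_foldr _ _ _ _ s (fun=> [::]) (fun a x r => f a x :: r)
  (fun a => esize (s a) * (esize (s a) + esize a) ^ d)) => //.
- exact: ptime_const.
- by apply: ptime_cons; [ptime_pre pf (fun y : H * (seq B * A) => (y.1, y.2.2)) |
  ptime_proj].
- pbound.
move=> a s1 s2 ->.
have -> : foldr (fun x r => f a x :: r) [::] s2 = map (f a) s2 by [].
apply: (@leq_trans (esize s2 * (esize s2 + esize a) ^ d)); last first.
  have le : esize s2 <= esize (s1 ++ s2).
    by have := @esize_cat _ EH s1 s2; have := @size_leq_esize _ EH s1; lia.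
  by rewrite leq_mul // leq_expl // leq_add2r.
elim: s2 => [|x s2 IH]; first by rewrite leq_pmulr // expn_gt0 ltnW.
rewrite map_cons !esize_cons mulnDl leq_add //.
  apply: (leq_trans (fd (x, a))); rewrite esize_pair /=.
  apply: leq_trans (leq_pmull _ (ltnW (esize_gt1 _))).
  by rewrite leq_expl //; lia.
apply: leq_trans IH _; rewrite leq_mul // leq_expl //; lia.
Qed.

End Folds.

(** * Boolean, arithmetic and list operations in polynomial time *)

Lemma ptime_ext (A : Type) {EA : Enc A} (B : Type) {EB : Enc B} (f g : A -> B) :
  f =1 g -> ptime g -> ptime f.
Proof. by move=> fg; apply: ptime_recode => a; rewrite fg. Qed.

Lemma ptime_andb (A : Type) {EA : Enc A} (b c : A -> bool) :
  ptime b -> ptime c -> ptime (fun a => b a && c a).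
Proof. by move=> pb pc; apply: ptime_if => //; apply: ptime_const. Qed.

Lemma ptime_orb (A : Type) {EA : Enc A} (b c : A -> bool) :
  ptime b -> ptime c -> ptime (fun a => b a || c a).
Proof. by move=> pb pc; apply: ptime_if => //; apply: ptime_const. Qed.

Lemma ptime_implb (A : Type) {EA : Enc A} (b c : A -> bool) :
  ptime b -> ptime c -> ptime (fun a => b a ==> c a).
Proof. by move=> pb pc; apply: ptime_if => //; apply: ptime_const. Qed.

Lemma ptime_negb (A : Type) {EA : Enc A} (b : A -> bool) : ptime b -> ptime
    (fun a => ~~ b a).
Proof. by move=> pb; apply: ptime_if => //; apply: ptime_const. Qed.

Lemma ptime_pred (A : Type) {EA : Enc A} (n : A -> nat) : ptime n -> ptime
    (fun a => (n a).-1).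
Proof.
move=> pn; apply: (@ptime_ext _ _ _ _ _ (fun a => if n a is m.+1 then m else 0)).
  by move=> a; case: (n a).
by apply: (@ptime_casenat _ _ _ _ n (fun=> 0) (fun _ m => m)) => //; ptime_proj.
Qed.

Lemma ptime_addn (A : Type) {EA : Enc A} (m n : A -> nat) :
  ptime m -> ptime n -> ptime (fun a => m a + n a).
Proof.
move=> pm pn; have [_ sm] := pm; have [_ sn] := pn.
have iterE a i : iter i succn (n a) = i + n a by elim: i => //= i ->.
apply: (@ptime_ext _ _ _ _ _ (fun a => iter (m a) succn (n a))) => [a|].
  by rewrite iterE.
apply: (@ptime_iter _ _ _ _ m n (fun _ => succn) (fun a => esize (m a) + esize (n
  a))) => //.
- by apply: ptime_succ; ptime_proj.
- by pbound.
- by move=> a i im; rewrite iterE !esize_nat; lia.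
Qed.

Lemma ptime_subn (A : Type) {EA : Enc A} (m n : A -> nat) :
  ptime m -> ptime n -> ptime (fun a => m a - n a).
Proof.
move=> pm pn; have [_ sm] := pm.
have iterE a i : iter i predn (m a) = m a - i.
  by elim: i => [|i /= ->]; rewrite ?subn0 // subnS.
apply: (@ptime_ext _ _ _ _ _ (fun a => iter (n a) predn (m a))) => [a|].
  by rewrite iterE.
apply: (@ptime_iter _ _ _ _ n m (fun _ => predn) (fun a => esize (m a))) => //.
- by apply: ptime_pred; ptime_proj.
- by move=> a i im; rewrite iterE !esize_nat; lia.
Qed.

Lemma ptime_eqn0 (A : Type) {EA : Enc A} (n : A -> nat) : ptime n -> ptime
    (fun a => n a == 0).
Proof.
move=> pn; apply: (@ptime_ext _ _ _ _ _ (fun a => if n a is m.+1 then false else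
  true)).
  by move=> a; case: (n a).
by apply: (@ptime_casenat _ _ _ _ n (fun=> true) (fun _ m => false)) => //;
  ptime_proj.
Qed.

Lemma ptime_leq (A : Type) {EA : Enc A} (m n : A -> nat) :
  ptime m -> ptime n -> ptime (fun a => m a <= n a).
Proof. by move=> pm pn; apply: ptime_eqn0; apply: ptime_subn. Qed.

Lemma ptime_eqn (A : Type) {EA : Enc A} (m n : A -> nat) :
  ptime m -> ptime n -> ptime (fun a => m a == n a).
Proof.
move=> pm pn.
apply: (@ptime_ext _ _ _ _ _ (fun a => (m a <= n a) && (n a <= m a))) => [a|].
  by rewrite eqn_leq.
by apply: ptime_andb; apply: ptime_leq.
Qed.

Lemma ptime_behead (A : Type) {EA : Enc A} (H : Type) {EH : Enc H}
    (s : A -> seq H) :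
  ptime s -> ptime (fun a => behead (s a)).
Proof.
move=> ps; apply: (@ptime_ext _ _ _ _ _ (fun a => if s a is x :: s' then s' else
  [::])).
  by move=> a; case: (s a).
by apply: (@ptime_caseseq _ _ _ _ _ _ s (fun=> [::]) (fun _ _ s' => s')) => //;
  ptime_proj.
Qed.

Lemma ptime_head (A : Type) {EA : Enc A} (H : Type) {EH : Enc H} (x : H)
    (s : A -> seq H) :
  ptime s -> ptime (fun a => head x (s a)).
Proof.
move=> ps; apply: (@ptime_ext _ _ _ _ _ (fun a => if s a is y :: s' then y else
  x)).
  by move=> a; case: (s a).
by apply: (@ptime_caseseq _ _ _ _ _ _ s (fun=> x) (fun _ y s' => y)) => //;
  ptime_proj.
Qed.

Lemma esize_drop (H : Type) {EH : Enc H} (i : nat) (s : seq H) :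
  esize (drop i s) <= esize s.
Proof.
elim: s i => [|x s IH] [|i] //=; apply: leq_trans (IH i) _.
by rewrite esize_cons leq_addl.
Qed.

Lemma ptime_nth (A : Type) {EA : Enc A} (H : Type) {EH : Enc H} (x : H)
    (s : A -> seq H) (n : A -> nat) :
  ptime s -> ptime n -> ptime (fun a => nth x (s a) (n a)).
Proof.
move=> ps pn; have [_ ss] := ps.
have iterE a i : iter i behead (s a) = drop i (s a).
  by elim: i => [|i /= ->]; rewrite ?drop0 // -drop1 drop_drop add1n.
apply: (@ptime_ext _ _ _ _ _ (fun a => head x (iter (n a) behead (s a)))) => [a|].
  by rewrite iterE -nth0 nth_drop addn0.
apply: ptime_head.
apply: (@ptime_iter _ _ _ _ n s (fun _ => behead) (fun a => esize (s a))) => //.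
- by apply: ptime_behead; ptime_proj.
- by move=> a i _; rewrite iterE esize_drop.
Qed.

Lemma ptime_muln (A : Type) {EA : Enc A} (m n : A -> nat) :
  ptime m -> ptime n -> ptime (fun a => m a * n a).
Proof.
move=> pm pn; have [_ sm] := pm; have [_ sn] := pn.
have iterE a i : iter i (addn (n a)) 0 = i * n a by elim: i => //= i ->.
apply: (@ptime_ext _ _ _ _ _ (fun a => iter (m a) (addn (n a)) 0)) => [a|].
  by rewrite iterE.
apply: (@ptime_iter _ _ _ _ m (fun=> 0) (fun a => addn (n a))
  (fun a => esize (m a) * esize (n a))) => //.
- exact: ptime_const.
- by apply: ptime_addn; [ptime_pre pn (fun y : nat * A => y.2) | ptime_proj].
- by pbound.
- move=> a i im; rewrite iterE !esize_nat;
  have := @leq_mul _ _ _ _ im (leqnn (n a)); lia.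
Qed.

Lemma esize_filter (H : Type) {EH : Enc H} (p : pred H) (s : seq H) :
  esize [seq x <- s | p x] <= esize s.
Proof.
elim: s => //= x s IH; rewrite esize_cons; case: ifP => _.
  by rewrite esize_cons leq_add2l.
by apply: leq_trans IH _; rewrite leq_addl.
Qed.

Lemma ptime_filter (A : Type) {EA : Enc A} (H : Type) {EH : Enc H}
    (s : A -> seq H) (p : A -> H -> bool) :
  ptime (fun y : H * A => p y.2 y.1) -> ptime s ->
  ptime (fun a => [seq x <- s a | p a x]).
Proof.
move=> pp ps; have [_ ss] := ps.
apply: (@ptime_foldr _ _ _ _ _ _ s (fun=> [::])
  (fun a x r => if p a x then x :: r else r) (fun a => esize (s a))) => //.
- exact: ptime_const.
- apply: ptime_if; last by ptime_proj.
    by ptime_pre pp (fun y : H * (seq H * A) => (y.1, y.2.2)).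
  by apply: ptime_cons; ptime_proj.
move=> a s1 s2 ->.
apply: (@leq_trans (esize s2)); last first.
  by have := @esize_cat _ EH s1 s2; have := @size_leq_esize _ EH s1; lia.
exact: (esize_filter (p a)).
Qed.

Lemma ptime_has (A : Type) {EA : Enc A} (H : Type) {EH : Enc H} (s : A -> seq H)
    (p : A -> H -> bool) :
  ptime (fun y : H * A => p y.2 y.1) -> ptime s ->
  ptime (fun a => has (p a) (s a)).
Proof.
move=> pp ps.
apply: (@ptime_foldr _ _ _ _ _ _ s (fun=> false)
  (fun a x r => p a x || r) (fun a => 4)) => //.
- exact: ptime_const.
- by apply: ptime_orb; [ptime_pre pp (fun y : H * (bool * A) => (y.1, y.2.2)) |
  ptime_proj].
- exact: pbounded_const.
- by move=> *; apply: esize_bool.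
Qed.

Lemma ptime_all (A : Type) {EA : Enc A} (H : Type) {EH : Enc H} (s : A -> seq H)
    (p : A -> H -> bool) :
  ptime (fun y : H * A => p y.2 y.1) -> ptime s ->
  ptime (fun a => all (p a) (s a)).
Proof.
move=> pp ps.
apply: (@ptime_foldr _ _ _ _ _ _ s (fun=> true)
  (fun a x r => p a x && r) (fun a => 4)) => //.
- exact: ptime_const.
- by apply: ptime_andb; [ptime_pre pp (fun y : H * (bool * A) => (y.1, y.2.2)) |
  ptime_proj].
- exact: pbounded_const.
- by move=> *; apply: esize_bool.
Qed.

Lemma ptime_size (A : Type) {EA : Enc A} (H : Type) {EH : Enc H}
    (s : A -> seq H) :
  ptime s -> ptime (fun a => size (s a)).
Proof.
move=> ps; have [_ ss] := ps.
apply: (@ptime_foldr _ _ _ _ _ _ s (fun=> 0) (fun a x r => r.+1)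
  (fun a => esize (s a))) => //.
- exact: ptime_const.
- by apply: ptime_succ; ptime_proj.
- move=> a s1 s2 ->; have -> : foldr (fun _ r => r.+1) 0 s2 = size s2 by [].
  have := @size_leq_esize _ EH (s1 ++ s2); rewrite esize_nat size_cat; lia.
Qed.

Lemma ptime_cat (A : Type) {EA : Enc A} (H : Type) {EH : Enc H}
    (s s' : A -> seq H) :
  ptime s -> ptime s' -> ptime (fun a => s a ++ s' a).
Proof.
move=> ps ps'; have [_ ss] := ps; have [_ ss'] := ps'.
apply: (@ptime_ext _ _ _ _ _ (fun a => foldr cons (s' a) (s a))) => [a|].
  by elim: (s a) => //= x t <-.
apply: (@ptime_foldr _ _ _ _ _ _ s s' (fun _ => cons)
  (fun a => esize (s a) + esize (s' a))) => //.
- by apply: ptime_cons; ptime_proj.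
- by pbound.
move=> a s1 s2 ->; have -> : foldr cons (s' a) s2 = s2 ++ s' a by elim: (s2) =>
  //= x t ->.
have := @esize_cat _ EH s2 (s' a); have := @esize_cat _ EH s1 s2.
have := @size_leq_esize _ EH s1; lia.
Qed.

Lemma ptime_count (A : Type) {EA : Enc A} (H : Type) {EH : Enc H}
    (s : A -> seq H) (p : A -> H -> bool) :
  ptime (fun y : H * A => p y.2 y.1) -> ptime s ->
  ptime (fun a => count (p a) (s a)).
Proof.
move=> pp ps; apply: (@ptime_ext _ _ _ _ _ (fun a => size [seq x <- s a | p a
  x])).
  by move=> a; rewrite size_filter.
by apply: ptime_size; apply: ptime_filter.
Qed.

Lemma ptime_flatten (A : Type) {EA : Enc A} (H : Type) {EH : Enc H}
    (s : A -> seq (seq H)) :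
  ptime s -> ptime (fun a => flatten (s a)).
Proof.
move=> ps; have [_ ss] := ps.
apply: (@ptime_foldr _ _ _ _ _ _ s (fun=> [::]) (fun _ => cat)
  (fun a => esize (s a))) => //.
- exact: ptime_const.
- by apply: ptime_cat; ptime_proj.
move=> a s1 s2 ->; apply: (@leq_trans (esize s2)); last first.
  by have := @esize_cat _ (@Enc_seq _ EH) s1 s2;
    have := @size_leq_esize _ (@Enc_seq _ EH) s1; lia.
elim: s2 => //= x s2 IH; rewrite esize_cons.
have := @esize_cat _ EH x (foldr cat [::] s2); lia.
Qed.

Lemma ptime_iota (A : Type) {EA : Enc A} (n : A -> nat) : ptime n -> ptime
    (fun a => iota 0 (n a)).
Proof.
move=> pn; have [_ sn] := pn.
have iterE i : iter i (fun s => 0 :: [seq x.+1 | x <- s]) [::] = iota 0 i.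
  by elim: i => //= i ->; rewrite (iotaDl 1 0).
apply: (@ptime_ext _ _ _ _ _
   (fun a => iter (n a) (fun s => 0 :: [seq x.+1 | x <- s]) [::])).
  by move=> a; rewrite iterE.
apply: (@ptime_iter _ _ _ _ n (fun=> [::])
  (fun _ s => 0 :: [seq x.+1 | x <- s]) (fun a => 2 + esize (n a) * (2 * esize (n
    a)))) => //.
- exact: ptime_const.
- apply: ptime_cons; first exact: ptime_const.
  by apply: (@ptime_map _ _ _ _ _ _ (fun y : seq nat * A => y.1) (fun _ =>
    succn));
    [apply: ptime_succ |]; ptime_proj.
- by pbound.
move=> a i le; rewrite iterE.
have bound j m : esize (iota m j) <= 2 + j * (2 * (m + j).+1).
  elim: j m => // j IH m; rewrite -[iota m j.+1]/(m :: iota m.+1 j) esize_cons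
    esize_nat.
  have := IH m.+1; have -> : m.+1 + j = m + j.+1 by lia.
  by rewrite [j.+1 * _]mulSn; set B := j * _; lia.
apply: leq_trans (bound i 0) _; rewrite leq_add2l esize_nat add0n.
by apply: leq_mul; lia.
Qed.

(** Division by counting, in the form required by [ptime_iter]; quotient plus remainder never
    exceeds the number of rounds, so the intermediate pairs stay small. *)
Definition edivmod (m d : nat) : nat * nat :=
  iter m (fun qr => if qr.2.+1 == d then (qr.1.+1, 0) else (qr.1, qr.2.+1))
    (0, 0).

Lemma edivmodE (m d : nat) : 0 < d -> edivmod m d = (m %/ d, m %% d).
Proof.
move=> d0; have: (edivmod m d).2 < d /\ m = (edivmod m d).1 * d + (edivmod m d).2.
  rewrite /edivmod; elim: m => //= m; case: (iter m _ _) => q r /= [rd E].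
  by case: eqP => /= F; split; lia.
case: (edivmod m d) => q r /= [rd ->]; rewrite divnMDl // modnMDl.
by rewrite divn_small // modn_small // addn0.
Qed.

Lemma ptime_edivmod (A : Type) {EA : Enc A} (m d : A -> nat) :
  ptime m -> ptime d -> ptime (fun a => edivmod (m a) (d a)).
Proof.
move=> pm pd; have [_ sm] := pm.
apply: (@ptime_iter _ _ _ _ m (fun=> (0, 0)) (fun a qr => if qr.2.+1 == d a
  then (qr.1.+1, 0) else (qr.1, qr.2.+1)) (fun a => esize (m a) + 2)) => //.
- exact: ptime_const.
- apply: ptime_if.
  + apply: ptime_eqn; first by apply: ptime_succ; ptime_proj.
    by ptime_pre pd (fun y : nat * nat * A => y.2).
  + apply: ptime_pair; last exact: ptime_const.
    by apply: ptime_succ; ptime_proj.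
  + by apply: ptime_pair; last apply: ptime_succ; ptime_proj.
- by pbound.
move=> a i le; rewrite esize_pair !esize_nat.
set qr := iter _ _ _.
suff: qr.1 + qr.2 <= i by lia.
rewrite /qr; elim: (i) => //= j; case: (iter j _ _) => q r /=.
by case: ifP => /= _; lia.
Qed.

Ltac ptime_auto :=
  lazymatch goal with
  | H : ptime_wrt _ ?f |- ptime_wrt _ ?f => exact: H
  | H : ptime_wrt _ ?f |- ptime_wrt _ (fun a => ?f _) =>
      apply: (ptime_comp H); ptime_auto
  | |- ptime_wrt _ (fun a => fst _) => apply: ptime_fst; ptime_auto
  | |- ptime_wrt _ (fun a => snd _) => apply: ptime_snd; ptime_auto
  | |- ptime_wrt _ fst => apply: ptime_fst; exact: ptime_id
  | |- ptime_wrt _ snd => apply: ptime_snd; exact: ptime_id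
  | |- ptime_wrt _ (fun a => pair _ _) => apply: ptime_pair; ptime_auto
  | |- ptime_wrt _ (fun a => if _ then _ else _) => apply: ptime_if; ptime_auto
  | |- ptime_wrt _ (fun a => andb _ _) => apply: ptime_andb; ptime_auto
  | |- ptime_wrt _ (fun a => orb _ _) => apply: ptime_orb; ptime_auto
  | |- ptime_wrt _ (fun a => implb _ _) => apply: ptime_implb; ptime_auto
  | |- ptime_wrt _ (fun a => negb _) => apply: ptime_negb; ptime_auto
  | |- ptime_wrt _ (fun a => leq _ _) => apply: ptime_leq; ptime_auto
  | |- ptime_wrt _ (fun a => eq_op _ _) => apply: ptime_eqn; ptime_auto
  | |- ptime_wrt _ (fun a => addn _ _) => apply: ptime_addn; ptime_auto
  | |- ptime_wrt _ (fun a => subn _ _) => apply: ptime_subn; ptime_auto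
  | |- ptime_wrt _ (fun a => muln _ _) => apply: ptime_muln; ptime_auto
  | |- ptime_wrt _ (fun a => S _) =>
      first [exact: ptime_const | apply: ptime_succ; ptime_auto]
  | |- ptime_wrt _ (fun a => edivmod _ _) => apply: ptime_edivmod; ptime_auto
  | |- ptime_wrt _ (fun a => cons _ _) => apply: ptime_cons; ptime_auto
  | |- ptime_wrt _ (fun a => cat _ _) => apply: ptime_cat; ptime_auto
  | |- ptime_wrt _ (fun a => flatten _) => apply: ptime_flatten; ptime_auto
  | |- ptime_wrt _ (fun a => map _ _) => apply: ptime_map; ptime_auto
  | |- ptime_wrt _ (fun a => filter _ _) => apply: ptime_filter; ptime_auto
  | |- ptime_wrt _ (fun a => has _ _) => apply: ptime_has; ptime_auto
  | |- ptime_wrt _ (fun a => all _ _) => apply: ptime_all; ptime_auto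
  | |- ptime_wrt _ (fun a => count _ _) => apply: ptime_count; ptime_auto
  | |- ptime_wrt _ (fun a => size _) => apply: ptime_size; ptime_auto
  | |- ptime_wrt _ (fun a => nth _ _ _) => apply: ptime_nth; ptime_auto
  | |- ptime_wrt _ (fun a => iota 0 _) => apply: ptime_iota; ptime_auto
  | |- ptime_wrt _ (fun a => a) => exact: ptime_id
  | |- _ => first [exact: ptime_const | assumption | idtac]
  end.

(** * The search algorithm *)

(** Nested so that [enc] yields exactly the list built by [enc_instance]. *)
Definition instance : Type :=
  nat * (seq (seq bool) * (seq bool * (nat * (nat * (nat * (nat *
    (seq (nat * nat) * unit))))))).

Implicit Types (x : instance).
Definition in_order x := x.1.
Definition in_adj x := x.2.1.
Definition in_terms x := x.2.2.1.
Definition in_t x := x.2.2.2.1.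
Definition in_k x := x.2.2.2.2.1.
Definition in_p x := x.2.2.2.2.2.1.
Definition in_p' x := x.2.2.2.2.2.2.1.
Definition in_rep x := x.2.2.2.2.2.2.2.1.

Definition adjb x (u v : nat) : bool := nth false (nth [::] (in_adj x) u) v.
Definition termb x (u : nat) : bool := nth false (in_terms x) u.

Definition budget x := in_t x + in_k x.

(** The numbers counted form an initial segment, whose length is the square root rounded up. *)
Definition ceil_sqrt (m : nat) : nat := count (fun i => i * i < m) (iota 0 m).

Definition width x := ceil_sqrt (budget x).

(** Instance, root of the tree and shift of the separating columns. *)
Definition params : Type := instance * (nat * nat).

(** Cells in separating columns get key 0, the others are numbered by strip, then
    by row; cells of nonzero key at distance at most 2 have keys at distance at
    most 2. *)
Definition key (c : params) (u : nat) : nat :=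
  let cell := nth (0, 0) (in_rep c.1) u in
  let qr := edivmod (cell.2 + c.2.2) (width c.1) in
  if qr.2 <= 1 then 0 else (qr.1 * in_p c.1 + cell.1).+1.

Definition key_bound x := ((in_p' x + width x) * in_p x).+1.

Definition item : Type := nat * nat.
(** The number of non-terminals paid for so far, and the current bag. *)
Definition state : Type := nat * seq item.
Implicit Types (z : item) (bag : seq item) (st : state).

Definition in_bag z bag : bool :=
  has (fun y : item => (y.1 == z.1) && (y.2 == z.2)) bag.

Definition has_parent (c : params) bag z : bool :=
  if z.2 == 0 then z.1 == c.2.1
  else has (fun y : item => (y.2.+1 == z.2) && adjb c.1 z.1 y.1) bag.

Definition has_cover (c : params) bag (u : nat) : bool :=
  has (fun z : item => (z.1 == u) || adjb c.1 u z.1) bag.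

Definition stage_ok (c : params) (stage : nat) bag : bool :=
  all (fun z : item => (key c z.1 == stage) ==> has_parent c bag z) bag
  && all (fun u => (termb c.1 u && (key c u == stage)) ==> has_cover c bag u)
       (iota 0 (in_order c.1)).

Definition stage_cost (c : params) (stage : nat) bag : nat :=
  count (fun z : item => (key c z.1 == stage) && ~~ termb c.1 z.1) bag.

(** An item may enter a bag no later than the stage of its key and may leave only after that stage.
    Hence each item is present at its own stage, where [stage_ok] checks its parent and [stage_cost]
    charges for it. *)
Definition transition (c : params) (stage : nat) st0 st : bool :=
  [&& st.1 == st0.1 + stage_cost c stage st.2,
      all (fun z : item => (stage <= key c z.1) ==> in_bag z st.2) st0.2 &
      all (fun z : item => (key c z.1 < stage) ==> in_bag z st0.2) st.2].

Definition next_layer (c : params) (states : seq state) (layer : seq state)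
    (stage : nat) : seq state :=
  [seq st <- states | stage_ok c stage st.2
     && has (fun st0 : state => transition c stage st0 st) layer].

Definition last_layer (c : params) (states : seq state) : seq state :=
  foldl (next_layer c states) [:: (0, [::])] (iota 0 (key_bound c.1)).

Definition all_states x (bags : seq (seq item)) : seq state :=
  flatten [seq [seq (i, bag) | bag <- bags] | i <- iota 0 (in_k x).+1].

Definition search x (bags : seq (seq item)) : bool :=
  has (fun rho => has (fun r =>
         0 < size (last_layer (x, (rho, r)) (all_states x bags)))
       (iota 0 (width x))) (iota 0 (in_order x)).

Definition all_items x : seq item :=
  flatten [seq [seq (u, d) | d <- iota 0 (in_order x)] | u <- iota 0 (in_order
    x)].

Definition bags_upto (m : nat) (items : seq item) : seq (seq item) :=
  iter m (fun bags => [::] :: flatten [seq [seq z :: bag | bag <- bags] | z <-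
    items])
    [:: [::]].

(** [51 * (2 * s + 2 * s + 5 * s)]: 51 vertices in each of [2 * s] separating
    cells, their parents, and 51 vertices in each cell of five rows of a strip of
    width [s]. *)
Definition bag_size x : nat := 459 * width x.

Definition solve x : bool := search x (bags_upto (bag_size x) (all_items x)).

(** * The search runs in time polynomial in the instance and the list of bags *)

Section InstanceQueries.
Variables (A : Type).
Context {EA : Enc A}.

Lemma ptime_adjb (x : A -> instance) (u v : A -> nat) :
  ptime x -> ptime u -> ptime v -> ptime (fun a => adjb (x a) (u a) (v a)).
Proof. by move=> px pu pv; rewrite /adjb /in_adj; ptime_auto. Qed.

Lemma ptime_termb (x : A -> instance) (u : A -> nat) :
  ptime x -> ptime u -> ptime (fun a => termb (x a) (u a)).
Proof. by move=> px pu; rewrite /termb /in_terms; ptime_auto. Qed.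

Lemma ptime_width (x : A -> instance) : ptime x -> ptime (fun a => width (x a)).
Proof.
by move=> px; rewrite /width /ceil_sqrt /budget /in_t /in_k; ptime_auto.
Qed.

Lemma ptime_in_bag (z : A -> item) (bag : A -> seq item) :
  ptime z -> ptime bag -> ptime (fun a => in_bag (z a) (bag a)).
Proof. by move=> pz pb; rewrite /in_bag; ptime_auto. Qed.

End InstanceQueries.

Ltac ptime_inst :=
  repeat (ptime_auto; first [apply: ptime_adjb | apply: ptime_termb |
    apply: ptime_width | apply: ptime_in_bag]); ptime_auto.

Lemma ptime_key (A : Type) {EA : Enc A} (c : A -> params) (u : A -> nat) :
  ptime c -> ptime u -> ptime (fun a => key (c a) (u a)).
Proof. by move=> pc pu; rewrite /key /in_rep /in_p; ptime_inst. Qed.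

Ltac ptime_inst ::=
  repeat (ptime_auto; first [apply: ptime_adjb | apply: ptime_termb |
    apply: ptime_width | apply: ptime_in_bag | apply: ptime_key]); ptime_auto.

Lemma ptime_stage_ok (A : Type) {EA : Enc A} (c : A -> params) (i : A -> nat)
    (bag : A -> seq item) :
  ptime c -> ptime i -> ptime bag ->
  ptime (fun a => stage_ok (c a) (i a) (bag a)).
Proof.
move=> pc pi pb; rewrite /stage_ok /has_parent /has_cover /in_order.
by ptime_inst.
Qed.

Lemma ptime_transition (A : Type) {EA : Enc A} (c : A -> params) (i : A -> nat)
    (st0 st : A -> state) :
  ptime c -> ptime i -> ptime st0 -> ptime st ->
  ptime (fun a => transition (c a) (i a) (st0 a) (st a)).
Proof.
by move=> pc pi p0 p1; rewrite /transition /stage_cost; ptime_inst.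
Qed.

Lemma ptime_next_layer (A : Type) {EA : Enc A} (c : A -> params)
    (sts layer : A -> seq state) (i : A -> nat) :
  ptime c -> ptime sts -> ptime layer -> ptime i ->
  ptime (fun a => next_layer (c a) (sts a) (layer a) (i a)).
Proof.
move=> pc ps pl pi; rewrite /next_layer; ptime_auto.
  by apply: ptime_stage_ok; ptime_auto.
by apply: ptime_transition; ptime_auto.
Qed.

Lemma ptime_last_layer (A : Type) {EA : Enc A} (c : A -> params)
    (sts : A -> seq state) :
  ptime c -> ptime sts -> ptime (fun a => last_layer (c a) (sts a)).
Proof.
move=> pc ps; have [_ ss] := ps; pose init : seq state := [:: (0, [::])].
apply: (@ptime_foldl _ _ _ _ _ _ (fun a => iota 0 (key_bound (c a).1))
  (fun=> init) (fun a => next_layer (c a) (sts a))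
  (fun a => esize init + esize (sts a))).
- by rewrite /key_bound /in_p' /in_p; ptime_inst.
- exact: ptime_const.
- by apply: ptime_next_layer; ptime_auto.
- by pbound.
- move=> a s1 s2 _; elim/last_ind: s1 => [|s1 i _]; first exact: leq_addr.
  rewrite foldl_rcons; apply: leq_trans (leq_addl _ _); exact: esize_filter.
Qed.

Lemma ptime_search : ptime (fun y : instance * seq (seq item) => search y.1 y.2).
Proof.
rewrite /search /in_order; ptime_auto; last by ptime_inst.
apply: ptime_last_layer; first by ptime_auto.
by rewrite /all_states /in_k; ptime_auto.
Qed.

Lemma ptime_all_items : ptime all_items.
Proof. by rewrite /all_items /in_order; ptime_auto. Qed.

(** * The cost of listing the bags *)

Lemma esize_gt3_cons (A : Type) {EA : Enc A} (a : A) (s : seq A) :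
  4 <= esize (a :: s).
Proof. by rewrite esize_cons (@leq_add 2 2). Qed.

Lemma esize_extend (items : seq item) (bags : seq (seq item)) :
  esize (flatten [seq [seq z :: bag | bag <- bags] | z <- items]) <=
  2 + 2 * esize bags * esize items.
Proof.
have ext z : esize [seq z :: bag | bag <- bags] <= 2 * esize z * esize bags.
  have z2 : 1 < esize z by exact: esize_gt1.
  elim: bags => [|bag bags IH]; first by rewrite -[esize (map _ _)]/2; nia.
  have b2 : 1 < esize bag by exact: esize_gt1.
  by rewrite map_cons !esize_cons; nia.
elim: items => [|z items IH]; first by rewrite -[esize (flatten _)]/2; lia.
rewrite map_cons -[flatten _]/(_ ++ flatten _) esize_cons -(leq_add2r 2)
  esize_cat.
by have := ext z; nia.
Qed.

(** The bags are too many to be listed in time polynomial in the instance: running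
    times are measured against this bound instead. *)
Definition search_cost x : nat := esize x ^ (bag_size x).+1.

Lemma esize_bags_upto (m : nat) (items : seq item) :
  esize (bags_upto m items) <= 4 * (2 * esize items + 1) ^ m.
Proof.
elim: m => [|m IH]; first by rewrite expn0.
rewrite /bags_upto iterS -/(bags_upto m items) esize_cons.
have b4 : 4 <= esize (bags_upto m items) by case: (m) => [|m'] //=;
  apply: esize_gt3_cons.
rewrite -[esize [::]]/2.
apply: leq_trans (_ : esize (bags_upto m items) * (2 * esize items + 1) <= _).
  by have := esize_extend items (bags_upto m items); nia.
by rewrite expnSr mulnA leq_mul2r IH orbT.
Qed.

Lemma search_cost_gt1 x : 1 < search_cost x.
Proof.
rewrite /search_cost; apply: (@leq_trans (esize x ^ 1));
  first by rewrite expn1 esize_gt1.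
by rewrite leq_pexp2l // ltnW // esize_gt1.
Qed.
#[local] Hint Resolve search_cost_gt1 : core.

Lemma pbounded_search_cost (T : instance -> nat) :
  pbounded esize T -> pbounded search_cost T.
Proof.
apply: (@pbounded_comp _ _ _ id); exists 1 => x; rewrite expn1 /search_cost.
by rewrite -{1}[esize x]expn1 leq_pexp2l // ltnW // esize_gt1.
Qed.

Lemma ptime_search_cost (B : Type) {EB : Enc B} (f : instance -> B) :
  ptime f -> ptime_wrt search_cost f.
Proof.
move=> pf; apply: (ptime_comp_wrt _ pf) => //; apply: ptime_id_wrt => //.
exact: pbounded_search_cost (pbounded_refl _).
Qed.

Definition extend_bags (items : seq item) (bags : seq (seq item)) :=
  [::] :: flatten [seq [seq z :: bag | bag <- bags] | z <- items].

(** The listing is a fold of [bag_size x] rounds, each polynomial in the current list; the final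
    length bounds all intermediate ones, and [search_cost] is chosen to dominate it. *)
Lemma ptime_wrt_bags :
  ptime_wrt search_cost (fun x => bags_upto (bag_size x) (all_items x)).
Proof.
have bagsE items (s : seq unit) : foldl (fun bags _ => extend_bags items bags)
    [:: [::]] s = bags_upto (size s) items.
  rewrite /bags_upto; elim: s [:: [::]] => // u s IH b.
  by rewrite -[size (u :: s)]/(size s).+1 iterSr -IH.
apply: (@ptime_recode_wrt _ _ _ _ _ _ _ _ (fun x => foldl
    (fun bags _ => extend_bags (all_items x) bags) [:: [::]]
    (nseq (bag_size x) tt))).
  by move=> x; rewrite bagsE size_nseq.
have pit := ptime_all_items; have [_ [d itd]] := pit.
have pbs : ptime bag_size by rewrite /bag_size; ptime_inst.
apply: (@ptime_foldl_wrt _ _ _ search_cost_gt1 _ _ _ _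
  (fun x => nseq (bag_size x) tt)
  (fun=> [:: [::]]) (fun x bags _ => extend_bags (all_items x) bags)
  (fun x => 4 * (2 * esize (all_items x) + 1) ^ bag_size x)).
- exact: pbounded_search_cost (pbounded_refl _).
- by apply: ptime_search_cost; apply: ptime_recode pbs => x; rewrite -enc_unary.
- by apply: ptime_search_cost; apply: ptime_const.
- by rewrite /extend_bags; ptime_auto.
- apply: pbounded_mul; first exact: pbounded_const.
  (* [d] bounds the size of the item list; two further factors [esize x], each at least 2, absorb
     the affine expression in that size. *)
  exists (d + 2) => x; rewrite -expnM (mulnC _ (d + 2)).
  apply: (@leq_trans ((esize x ^ (d + 2)) ^ bag_size x)).
    apply: leq_expl; rewrite expnD.
    have z2 : 1 < esize (all_items x) by exact: esize_gt1.
    have x2 : 1 < esize x by exact: esize_gt1.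
    have := itd x => itx; apply: (@leq_trans (esize x ^ d * 4)); first by lia.
    by rewrite leq_mul2l; apply/orP; right; rewrite -mulnn (@leq_mul 2 2).
  by rewrite /search_cost -!expnM leq_pexp2l // leq_mul2l leqnSn orbT.
- move=> x s1 s2 E; rewrite bagsE; apply: leq_trans (esize_bags_upto _ _) _.
  rewrite leq_mul2l /= leq_pexp2l ?addn1 //.
  by have := congr1 size E; rewrite size_nseq size_cat => ->; apply: leq_addr.
Qed.

Lemma ptime_wrt_solve : ptime_wrt search_cost solve.
Proof.
apply: (ptime_comp_wrt search_cost_gt1 ptime_search
  (g := fun x => (x, bags_upto (bag_size x) (all_items x)))).
apply: (ptime_pair_wrt search_cost_gt1 _ ptime_wrt_bags).
by apply: ptime_search_cost; apply: ptime_id.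
Qed.

(** * Truncation of [k] and the complete program *)

Definition capped x : instance :=
  (in_order x, (in_adj x, (in_terms x, (in_t x,
    (minn (in_order x) (in_k x), x.2.2.2.2.2))))).

(** Reading all of [k] could take longer than the time bound allows when [k] is
    much larger than [n], so [k] is first truncated in time linear in [n]. *)
Definition cap_body : expr :=
  ECase (EVar 0) ELeaf (ECase (EVar 0) ELeaf (ECase (EVar 3) ELeaf
    (ENode ELeaf (ECall 1 (ENode (EVar 3) (EVar 1)))))).

(** The five case distinctions leave [n], the matrix, the terminals, [t] and [k] in variables 8, 6,
    4, 2 and 0, and the rest of the instance in variable 1. *)
Definition main_body (i : nat) : expr :=
  ECase (EVar 0) ELeaf (ECase (EVar 1) ELeaf (ECase (EVar 1) ELeaf
  (ECase (EVar 1) ELeaf (ECase (EVar 1) ELeaf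
    (ECall i (ENode (EVar 8) (ENode (EVar 6) (ENode (EVar 4) (ENode (EVar 2)
      (ENode (ECall 1 (ENode (EVar 8) (EVar 0))) (EVar 1))))))))))).

Lemma eval_cap (P : program) (n k : nat) : body P 1 = cap_body ->
  exists2 m, m <= 20 * n.+1 &
    eval P [:: Node (enc n) (enc k)] (body P 1) (enc (minn n k)) m.
Proof.
move=> P1; rewrite P1; elim: n k => [|n IH] k.
  exists (1 + (1 + 1).+1).+1 => //; rewrite min0n.
  apply: eval_case_node; first exact: eval_var.
  by apply: eval_case_leaf; [apply: eval_var | apply: eval_leaf].
case: k => [|k].
  exists (1 + (1 + (1 + 1).+1).+1).+1; first by lia.
  apply: eval_case_node; first exact: eval_var.
  apply: eval_case_node; first exact: eval_var.
  by apply: eval_case_leaf; [apply: eval_var | apply: eval_leaf].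
have [m mle em] := IH k.
exists (1 + (1 + (1 + (1 + ((1 + 1).+1 + m).+1).+1).+1).+1).+1; first by lia.
rewrite minnSS; apply: eval_case_node; first exact: eval_var.
apply: eval_case_node; first exact: eval_var.
apply: eval_case_node; first exact: eval_var.
apply: eval_node; first exact: eval_leaf.
apply: eval_call; last by rewrite P1; apply: em.
by apply: eval_node; apply: eval_var.
Qed.

Lemma program_solve : exists P d, forall x, exists2 m,
  m <= 20 * (in_order x).+1 + search_cost (capped x) ^ d + 30 &
  runs P (enc x) (enc (solve (capped x))) m.
Proof.
have [codes _] := ptime_wrt_solve.
(* Offset 2, since functions 0 and 1 are [main_body] and [cap_body]. *)
have [Q [i [T [d Td] hQ]]] := codes 2.
exists ([:: main_body i; cap_body] ++ Q ++ [::]), d => x.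
set P := _ ++ _.
have [m mle em] := hQ [:: main_body i; cap_body] [::] erefl (capped x).
have [m' m'le em'] := @eval_cap P (in_order x) (in_k x) erefl.
exists ((1 + (1 + (1 + (1 + (1 + ((1 + (1 + (1 + (1 +
  (((1 + 1).+1 + m').+1 + 1).+1).+1).+1).+1).+1
  + m).+1).+1).+1).+1).+1).+1).
  by have := Td (capped x); lia.
case: x mle em m'le em' => n [M [R [t [k rest]]]] mle em m'le em'.
do 5 (apply: eval_case_node; first exact: eval_var).
apply: eval_call em.
do 4 (apply: eval_node; first exact: eval_var).
apply: eval_node; last exact: eval_var.
by apply: eval_call em'; apply: eval_node; apply: eval_var.
Qed.

(** * Soundness *)

Lemma in_bagP (z : item) (bag : seq item) : reflect (z \in bag) (in_bag z bag).
Proof.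
apply: (iffP hasP) => [[y yb]|zb]; last by exists z; rewrite ?eqxx.
by case: z y yb => [a b] [a' b'] yb /= /andP[/eqP <- /eqP <-].
Qed.

Lemma mem_all_items (x : instance) (z : item) :
  (z \in all_items x) = (z.1 < in_order x) && (z.2 < in_order x).
Proof.
apply/allpairsP/andP => [[[u d] /= []]|[z1 z2]].
  by rewrite !mem_iota /= => ? ? ->.
by exists (z.1, z.2); rewrite !mem_iota /= -surjective_pairing.
Qed.

Lemma mem_bags_upto (m : nat) (items bag : seq item) :
  (bag \in bags_upto m items) = (size bag <= m) && all [in items] bag.
Proof.
elim: m bag => [|m IH] bag.
  by rewrite inE; case: bag.
rewrite /bags_upto iterS -/(bags_upto m items) inE.
case: bag => [|z bag] //=.
apply/allpairsP/andP => [[[y b] /= [yi]]|[sb /andP[zi ab]]].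
  by rewrite IH => /andP[sb ab] [-> ->]; rewrite ltnS sb yi ab.
by exists (z, bag); rewrite /= IH zi ab -ltnS sb.
Qed.

Lemma mem_all_states (x : instance) (bags : seq (seq item)) (st : state) :
  (st \in all_states x bags) = (st.1 <= in_k x) && (st.2 \in bags).
Proof.
apply/allpairsP/andP => [[[i bag] [+ ? ->]]|[z1 z2]]; first by rewrite mem_iota.
by exists (st.1, st.2); rewrite mem_iota; split=> //; apply: surjective_pairing.
Qed.

Section Represents.
Variables (n p p' : nat) (G : sgraph 'I_n) (R : {set 'I_n}).
Variables (f : 'I_n -> 'I_p * 'I_p') (x : instance).

(** Nothing is said about [t] and [k], so that this applies to the truncated instance. *)
Definition represents : Prop :=
  [/\ [/\ in_order x = n, in_p x = p & in_p' x = p'],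
      forall u v : 'I_n, adjb x u v = G u v,
      forall u : 'I_n, termb x u = (u \in R) &
      forall u : 'I_n, nth (0, 0) (in_rep x) u = ((f u).1 : nat, (f u).2 : nat)].

Hypothesis xP : represents.

Lemma key_lt (rho r : nat) (u : 'I_n) :
  r < width x -> key (x, (rho, r)) u < key_bound x.
Proof.
case: xP => [[_ Ep Ep'] _ _ Ef] rw; rewrite /key /key_bound Ef Ep Ep' /=.
rewrite edivmodE ?(leq_trans _ rw) //=; case: ifP => // _; rewrite ltnS.
set q := (X in X * p + _).
have q_le : q <= (f u).2 + r by apply: leq_div.
have ip := ltn_ord (f u).1; have jp := ltn_ord (f u).2.
have qw : q.+1 <= p' + width x by lia.
by apply: leq_trans (leq_mul qw (leqnn p)); rewrite mulSn; lia.
Qed.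

Section Soundness.
Variables (rho : 'I_n) (r : nat).
Hypothesis rw : r < width x.
Let c : params := (x, (rho : nat, r)).

(** Items that a certificate may refer to: those already collected, and those in the bag whose own
    stage is still to come. *)
Definition pending (stage : nat) (bag Z : seq item) (z : item) : Prop :=
  z \in Z \/ z \in bag /\ stage <= key c z.1.

Definition certified (Q : item -> Prop) (z : item) : Prop :=
  if z.2 == 0 then z.1 = rho
  else exists y, [/\ Q y, y.2.+1 = z.2 & adjb x z.1 y.1].

Definition dominated (Q : item -> Prop) (u : nat) : Prop :=
  exists2 z, Q z & (z.1 == u) || adjb x u z.1.

(** [Z] collects the items of all stages before [stage]. *)
Definition partial_solution (stage : nat) (st : state) (Z : seq item) : Prop :=
  [/\ forall z, z \in Z -> z.1 < n,
      forall z, z \in st.2 -> key c z.1 < stage -> z \in Z,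
      forall z, z \in Z -> certified (pending stage st.2 Z) z,
      forall u : 'I_n, u \in R -> key c u < stage ->
        dominated (pending stage st.2 Z) u &
      count (fun z => ~~ termb x z.1) Z <= st.1].

(** The collection grows by the bag items whose key is [stage]. Pending items remain pending or
    become collected, so earlier certificates survive, and the new items are certified by
    [stage_ok]. *)
Lemma next_layer_sound (bags : seq (seq item)) layer stage st :
  (forall bag z, bag \in bags -> z \in bag -> z.1 < n) ->
  (forall st0, st0 \in layer -> exists Z, partial_solution stage st0 Z) ->
  st \in next_layer c (all_states x bags) layer stage ->
  [/\ st.1 <= in_k x, st.2 \in bags & exists Z, partial_solution stage.+1 st Z].
Proof.
case: xP => [[En _ _] Eadj Eterm _] bags_n layerP.
rewrite mem_filter mem_all_states => /andP[/andP[/andP[/allP hpar /allP hcov]]].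
case/hasP=> st0 /layerP[Z [Zn SZ Zpar Zcov Zcost]] /and3P[/eqP Ecost /allP keep
  /allP old].
case/andP=> stk stb; split=> //.
pose Z' := Z ++ [seq z <- st.2 | key c z.1 == stage]; exists Z'.
(* A bag item of smaller key was in the previous bag by [old], hence already collected. *)
have in_new z : z \in st.2 -> key c z.1 <= stage -> z \in Z'.
  move=> zS; rewrite mem_cat mem_filter zS andbT leq_eqVlt => /orP[->|lt].
    by rewrite orbT.
  by rewrite (SZ z) //; have := old z zS; rewrite lt => /in_bagP.
have new_pending z : z \in st.2 -> pending stage.+1 st.2 Z' z.
  move=> zS; case: (leqP (key c z.1) stage) => le; last by right.
  by left; apply: in_new.
have old_pending z : pending stage st0.2 Z z -> pending stage.+1 st.2 Z' z.
  case=> [zZ|[zS le]]; first by left; rewrite mem_cat zZ.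
  by apply: new_pending; have := keep z zS; rewrite le => /in_bagP.
split=> /=.
- move=> z; rewrite mem_cat mem_filter => /orP[/Zn//|/andP[_ zS]].
  exact: bags_n zS.
- by move=> z zS; rewrite ltnS; apply: in_new.
- move=> z; rewrite mem_cat mem_filter => /orP[zZ|/andP[zk zS]].
    have := Zpar z zZ; rewrite /certified; case: ifP => // _ [y [py dy ay]].
    by exists y; split=> //; apply: old_pending.
  have := hpar z zS; rewrite zk /= /has_parent /certified; case: ifP => _.
    by move/eqP.
  by case/hasP=> y yS /andP[/eqP dy ay]; exists y; split=> //; apply: new_pending.
- move=> u uR; rewrite ltnS leq_eqVlt => /orP[uk|uk]; last first.
    have [z zp uz] := Zcov u uR uk; exists z => //; exact: old_pending.
  have := hcov u; rewrite mem_iota En ltn_ord /= => /(_ isT).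
  rewrite Eterm uR uk /= => /hasP[z zS zu]; exists z => //; exact: new_pending.
- rewrite count_cat count_filter Ecost leq_add //.
  by rewrite /stage_cost; apply: sub_count => z /= /andP[-> ->].
Qed.

Lemma last_layer_sound (bags : seq (seq item)) st :
  (forall bag z, bag \in bags -> z \in bag -> z.1 < n) ->
  st \in last_layer c (all_states x bags) ->
  [/\ st.1 <= in_k x, st.2 \in bags & exists Z, partial_solution (key_bound x) st
    Z].
Proof.
(* Unfolding shows that [key_bound] is a successor, so the last layer results from an actual step
   and its states satisfy the bounds of [all_states]. *)
move=> bags_n; rewrite /last_layer [c.1]/= {1}/key_bound.
have iota_rcons m : iota 0 m.+1 = rcons (iota 0 m) m by rewrite -addn1 iotaD
  cats1.
set states := all_states x bags; set init := [:: _].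
have layerP m st0 : st0 \in foldl (next_layer c states) init (iota 0 m) ->
    exists Z, partial_solution m st0 Z.
  elim: m st0 => [|m IH] st0.
    by rewrite inE => /eqP ->; exists [::]; split.
  by rewrite iota_rcons foldl_rcons => /(next_layer_sound bags_n IH)[].
rewrite iota_rcons foldl_rcons => /(next_layer_sound bags_n (layerP _)).
by rewrite -/(key_bound x).
Qed.

(** After the last stage every pending item has been collected. Following parents decreases the
    depth and ends at [rho], so [R] together with the vertices of [Z] is connected. *)
Lemma partial_solution_tree (bag : seq item) (i : nat) (Z : seq item) :
  0 < in_k x -> i <= in_k x -> (forall z, z \in bag -> z.1 < n) ->
  partial_solution (key_bound x) (i, bag) Z -> steiner_tree_yes G R (in_k x).
Proof.
case: xP => [_ Eadj Eterm _] k0 ik bag_n [Zn _ Zpar Zcov Zcost].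
have pendZ z : pending (key_bound x) bag Z z -> z \in Z.
  case=> // -[zS]; have zn := bag_n z zS.
  by rewrite leqNgt (key_lt rho (Ordinal zn) rw).
apply/steiner_yesP.
have covered u : u \in R -> exists2 v : 'I_n, exists2 z, z \in Z & z.1 = v & (v
  == u) || G u v.
  move=> uR; have [z /pendZ zZ] := Zcov u uR (key_lt _ _ rw).
  exists (Ordinal (Zn z zZ)); first by exists z.
  by rewrite -Eadj.
(* With no items there are no terminals either; the single vertex [rho] is then a solution because
   [k] is positive. *)
case: (posnP (size Z)) => [/size0nil Z0|sZ].
  exists [set rho], rho; rewrite ?inE //; split.
  - by move=> u; rewrite inE => /eqP ->.
  - by apply/subsetP=> u /covered[v [z]]; rewrite Z0.
  - by apply: leq_trans k0; rewrite -(cards1 rho) subset_leq_card ?subsetDl.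
pose W := [set u : 'I_n | (u \in R) || has (fun z : item => z.1 == u) Z].
have ZW z (u : 'I_n) : z \in Z -> z.1 = u -> u \in W.
  by move=> zZ zu; rewrite inE; apply/orP; right; apply/hasP; exists z;
    rewrite ?zu.
have conn m z (u : 'I_n) : z \in Z -> z.2 = m -> z.1 = u ->
    rho \in W /\ connect (induced G W) u rho.
  elim: m z u => [|m IH] z u zZ zm zu; have := Zpar z zZ;
    rewrite /certified zm /=.
    by rewrite zu => /ord_inj <-; split=> //; apply: ZW zu.
  case=> y [/pendZ yZ [ym] ay].
  have yn := Zn y yZ; have [rW cy] := IH y (Ordinal yn) yZ ym erefl.
  split=> //; apply: connect_trans cy; apply: connect1.
  rewrite /induced (ZW z u) // (ZW y (Ordinal yn)) //=.
  by rewrite -Eadj -zu.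
have [z0 z0Z] : exists z, z \in Z by case: (Z) sZ => // z ? _; exists z;
  apply: mem_head.
have [rW _] := conn _ z0 (Ordinal (Zn _ z0Z)) z0Z erefl erefl.
exists W, rho => //; split.
- move=> u; rewrite inE => /orP[uR|/hasP[z zZ /eqP zu]]; last first.
    by have [] := conn _ z u zZ erefl zu.
  have [v [z zZ zv] uv] := covered u uR.
  have [_ cv] := conn _ z v zZ erefl zv.
  case/orP: uv => [/eqP <- //|uv]; apply: connect_trans cv; apply: connect1.
  by rewrite /induced inE uR (ZW z v).
- by apply/subsetP => u uR; rewrite inE uR.
- apply: leq_trans (leq_trans Zcost ik).
  (* A vertex may occur in [Z] with several depths, so counting items can only overestimate the
     number of non-terminals. *)
  rewrite -size_filter -(size_map (fun z : item => z.1)).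
  rewrite cardE -(size_map (fun u : 'I_n => u : nat)).
  apply: uniq_leq_size; first by rewrite map_inj_uniq ?enum_uniq //;
    apply: ord_inj.
  move=> _ /mapP[u + ->]; rewrite mem_enum !inE => /andP[uR].
  rewrite (negbTE uR) /= => /hasP[z zZ /eqP zu]; apply/mapP; exists z => //.
  by rewrite mem_filter zZ zu Eterm uR.
Qed.

End Soundness.

Lemma solve_sound : 0 < in_k x -> solve x -> steiner_tree_yes G R (in_k x).
Proof.
case: (xP) => [[En _ _] _ _ _] k0 /hasP[rho]; rewrite mem_iota add0n En => /= rn.
case/hasP=> r; rewrite mem_iota add0n => /= rw.
set layer := last_layer _ _ => sl.
have [st stl] : exists st, st \in layer.
  by case: layer sl => // st ? _; exists st; apply: mem_head.
pose bags := bags_upto (bag_size x) (all_items x).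
have bags_n bag z : bag \in bags -> z \in bag -> z.1 < n.
  rewrite mem_bags_upto => /andP[_ /allP ab] /ab.
  by rewrite /= mem_all_items En => /andP[].
have [stk stb [Z ZP]] := @last_layer_sound (Ordinal rn) r bags st bags_n stl.
apply: (partial_solution_tree rw k0 stk _ (_ : partial_solution _ _ _ (st.1,
  st.2) Z)).
  by move=> z; apply: bags_n.
by rewrite -surjective_pairing; apply: ZP.
Qed.

End Represents.

(** * Completeness *)

Section Completeness.
Variables (n p p' : nat) (G : sgraph 'I_n) (R : {set 'I_n}).
Variables (f : 'I_n -> 'I_p * 'I_p') (x : instance).
Hypothesis xP : represents G R f x.

(** * From a suitable family of bags to an accepting run of the search *)

Section Sweep.
Variables (rho : 'I_n) (r : nat) (d : 'I_n -> nat) (par : 'I_n -> 'I_n).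
Variables (Q : {set 'I_n}) (bag : nat -> {set 'I_n}).
Hypothesis rw : r < width x.
Let c : params := (x, (rho : nat, r)).
Let ky (u : 'I_n) : nat := key c u.

Hypothesis rhoQ : d rho = 0.
Hypothesis d_lt : forall u, u \in Q -> d u < n.
Hypothesis parP : forall u, u \in Q -> u != rho -> G u (par u) /\ d u = (d (par
  u)).+1.
Hypothesis par_bag : forall u, u \in Q -> u != rho -> par u \in bag (ky u).
Hypothesis domQ : forall u, u \in R ->
  exists2 q, q \in Q & ky q = ky u /\ (q == u) || G u q.
Hypothesis bag_sub : forall i, bag i \subset Q.
Hypothesis bag_mem : forall u, u \in Q -> u \in bag (ky u).
Hypothesis bag_keep : forall i u, u \in bag i -> i < ky u -> u \in bag i.+1.
Hypothesis bag_old : forall i u, u \in bag i.+1 -> ky u <= i -> u \in bag i.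
Hypothesis bag_card : forall i, #|bag i| <= bag_size x.
Hypothesis costQ : #|Q :\: R| <= in_k x.

Let bag_seq (i : nat) : seq item := [seq (nat_of_ord u, d u) | u <- enum (bag i)].
Let cost (i : nat) : nat := #|[set u in Q :\: R | ky u < i]|.
Let states := all_states x (bags_upto (bag_size x) (all_items x)).

Lemma mem_bag_seq i (u : 'I_n) : u \in bag i -> (nat_of_ord u, d u) \in bag_seq i.
Proof. by move=> ui; apply/mapP; exists u; rewrite ?mem_enum. Qed.

Lemma bag_seqP i z : z \in bag_seq i -> exists2 u : 'I_n, u \in bag i & z =
    (nat_of_ord u, d u).
Proof. by case/mapP=> u; rewrite mem_enum => ? ->; exists u. Qed.

(** Bag [i] lies in [Q] and contains every vertex of [Q] with key [i], so each vertex is charged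
    exactly once. *)
Lemma sweep_cost i : cost i.+1 = cost i + stage_cost c i (bag_seq i).
Proof.
case: xP => [_ _ Eterm _].
have -> : stage_cost c i (bag_seq i) = #|[set u in Q :\: R | ky u == i]|.
  rewrite /stage_cost count_map -size_filter cardE.
  apply/perm_size/uniq_perm => [||u];
    [exact/filter_uniq/enum_uniq | exact: enum_uniq |].
  rewrite mem_filter !mem_enum !inE /= Eterm -/(ky u).
  case: eqP => [E|_]; rewrite ?andbF //= andbT.
  congr (_ && _); apply/idP/idP => [/(subsetP (bag_sub i))//|uQ].
  by rewrite -E; apply: bag_mem.
rewrite /cost -(cardsID [set u | ky u == i] [set u in _ | ky u < i.+1]) addnC.
congr (_ + _).
  by apply: eq_card => u; rewrite !inE ltnS ltn_neqAle; case: (ky u == i);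
    case: (u \in Q); case: (u \in R).
apply: eq_card => u; rewrite !inE ltnS; case: eqP => [->|_];
  last by rewrite !andbF.
by rewrite leqnn !andbT.
Qed.

Lemma sweep_state i : (cost i.+1, bag_seq i) \in states.
Proof.
case: (xP) => [[En _ _] _ _ _].
rewrite mem_all_states /= mem_bags_upto size_map -cardE bag_card andTb.
apply/andP; split.
  apply: leq_trans costQ; apply/subset_leq_card/subsetP => u.
  by rewrite inE => /andP[].
apply/allP => _ /bag_seqP[u ui ->]; rewrite /= mem_all_items /= En ltn_ord /=.
by apply: d_lt; apply: subsetP ui; apply: bag_sub.
Qed.

Lemma sweep_ok i : stage_ok c i (bag_seq i).
Proof.
case: (xP) => [[En _ _] Eadj Eterm _].
apply/andP; split; apply/allP.
  move=> _ /bag_seqP[u ui ->]; apply/implyP; rewrite /= -/(ky u) => /eqP ku.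
  have uQ : u \in Q by apply: subsetP ui; apply: bag_sub.
  rewrite /has_parent /=; have [->|ur] := eqVneq u rho;
    first by rewrite rhoQ eqxx.
  have [gp dp] := parP uQ ur; rewrite dp /=.
  apply/hasP; exists (nat_of_ord (par u), d (par u));
    last by rewrite /= eqxx Eadj.
  by rewrite -ku; apply: mem_bag_seq; apply: par_bag.
move=> v; rewrite mem_iota En => /= vn.
have [u ->] : exists u : 'I_n, v = u by exists (Ordinal vn).
apply/implyP; rewrite /c /= Eterm => /andP[uR /eqP ku].
have [q qQ [kq uq]] := domQ uR.
apply/hasP; exists (nat_of_ord q, d q); last by rewrite /c /= Eadj.
by rewrite -ku -[key _ u]/(ky u) -kq; apply: mem_bag_seq; apply: bag_mem.
Qed.

Lemma sweep_layer m :
  exists st, st \in foldl (next_layer c states) [:: (0, [::])] (iota 0 m.+1).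
Proof.
have iota_rcons i : iota 0 i.+1 = rcons (iota 0 i) i by rewrite -addn1 iotaD
  cats1.
exists (cost m.+1, bag_seq m); elim: m => [|m IH].
  rewrite /= mem_filter sweep_state sweep_ok andbT /= orbF /transition /=
    sweep_cost.
  rewrite eqn_add2r; apply/andP; split.
    by rewrite /cost cards_eq0; apply/eqP/setP => u; rewrite !inE ltn0 andbF.
  by apply/allP.
rewrite iota_rcons foldl_rcons mem_filter sweep_state sweep_ok andbT /=.
apply/hasP; exists (cost m.+1, bag_seq m) => //.
apply/and3P; split; first by rewrite /= sweep_cost.
  apply/allP => _ /bag_seqP[u ui ->]; apply/implyP => le; apply/in_bagP.
  by apply: mem_bag_seq; apply: bag_keep.
apply/allP => _ /bag_seqP[u ui ->]; apply/implyP => le; apply/in_bagP.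
by apply: mem_bag_seq; apply: bag_old.
Qed.

Lemma sweep_solve : solve x.
Proof.
case: (xP) => [[En _ _] _ _ _].
apply/hasP; exists (rho : nat); first by rewrite mem_iota En ltn_ord.
apply/hasP; exists r; first by rewrite mem_iota rw.
rewrite /last_layer [_.1]/= /key_bound;
  have [st] := sweep_layer ((in_p' x + width x) * in_p x).
by rewrite -/states -/c; case: foldl.
Qed.

End Sweep.
End Completeness.

(** * Integer square roots and unions of small sets *)

Lemma leq_ceil_sqrt (m : nat) : m <= ceil_sqrt m * ceil_sqrt m.
Proof.
rewrite leqNgt; apply/negP => lt; set s := ceil_sqrt m in lt.
have sm : s.+1 <= m by nia.
suff: s.+1 <= s by rewrite ltnn.
rewrite {2}/s /ceil_sqrt -(subnKC sm) iotaD count_cat.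
apply: leq_trans (leq_addr _ _); rewrite (eq_in_count (a2 := predT)).
  by rewrite count_predT size_iota.
by move=> i; rewrite mem_iota add0n /= subnKC // => lti; nia.
Qed.

Lemma ceil_sqrt_lt (m j : nat) : ceil_sqrt m = j.+1 -> j * j < m.
Proof.
move=> E; rewrite ltnNge; apply/negP => le.
suff: ceil_sqrt m <= j by rewrite E ltnn.
rewrite /ceil_sqrt -size_filter -[X in _ <= X](size_iota 0).
apply: uniq_leq_size; first by rewrite filter_uniq ?iota_uniq.
by move=> i; rewrite mem_filter !mem_iota => /andP[ij _]; nia.
Qed.

Lemma leq_card_bigcup (I T : finType) (A : {set I}) (F : I -> {set T}) (b : nat) :
  (forall i, i \in A -> #|F i| <= b) -> #|\bigcup_(i in A) F i| <= b * #|A|.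
Proof.
move=> Fb; rewrite mulnC -sum_nat_const.
elim/big_rec2: _ => [|i m S /Fb bi le]; first by rewrite cards0.
by apply: leq_trans (leq_card_setU _ _) _; rewrite leq_add.
Qed.

(** * The skeleton of a connected set *)

Section Ports.
Variables (V : finType) (p p' : nat) (G : sgraph V) (f : V -> 'I_p * 'I_p').
Hypothesis fP : is_representation G f.
Variables (W : {set V}) (w0 : V).
Hypotheses (w0W : w0 \in W)
  (connW : forall u, u \in W -> connect (induced G W) u w0).

Implicit Types (c : 'I_p * 'I_p').

Definition near c c' := dist_le2 c.1 c'.1 && dist_le2 c.2 c'.2.

Lemma near_sym c c' : near c c' = near c' c.
Proof. by congr (_ && _); apply: andbC. Qed.

Lemma near_edge u v : G u v -> near (f u) (f v).
Proof. by case: fP => _ h /h[h1 h2]; apply/andP. Qed.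

Lemma same_cell u v : f u = f v -> (u == v) || G u v.
Proof.
move=> E; have [->|uv] := eqVneq u v => //=; case: fP => h _.
by apply: (h (f u)); rewrite ?inE ?E.
Qed.

Lemma card_near c : #|[set c' | near c c']| <= 25.
Proof.
(* Both coordinate differences lie between -2 and 2; adding 2 makes them natural numbers below 5. *)
pose g c' : 'I_5 * 'I_5 := (inord (c'.1 + 2 - c.1), inord (c'.2 + 2 - c.2)).
rewrite -(@card_in_imset _ _ g).
  by apply: leq_trans (max_card _) _; rewrite card_prod !card_ord.
move=> [i j] [i' j']; rewrite !inE /near /dist_le2 /= => h h' [].
move/(congr1 val); rewrite /= !inordK; try lia.
move=> E1 /(congr1 val); rewrite /= !inordK; try lia.
by move=> E2; congr (_, _); apply: val_inj => /=; lia.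
Qed.

(** End points of one edge of [W] from cell [c] to cell [c'], if there is one. *)
Definition link c c' : V * V :=
  odflt (w0, w0) [pick e : V * V | [&& e.1 \in W, e.2 \in W, f e.1 == c,
    f e.2 == c' & G e.1 e.2]].

(** One representative, and end points of the links to and from at most 25 near cells:
    [1 + 25 + 25 = 51]. Both directions occur because [link] chooses an edge for each ordered pair
    of cells. *)
Definition ports c : {set V} :=
  odflt w0 [pick u in W | f u == c]
  |: ([set (link c c').1 | c' in [set c' | near c c']]
   :|: [set (link c' c).2 | c' in [set c' | near c c']]).

(** Testing [u] against the ports of its own cell discards the default [w0] from the ports of other
    cells. *)
Definition skeleton : {set V} := [set u in W | u \in ports (f u)].

Lemma card_ports c : #|ports c| <= 51.
Proof.
rewrite (leq_trans (leq_card_setU _ _)) // cards1 (@leq_add 1 _ 1 50) //.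
rewrite (leq_trans (leq_card_setU _ _)) // (@leq_add _ _ 25 25) //;
  by rewrite (leq_trans (leq_imset_card _ _)) ?card_near.
Qed.

Lemma card_skeleton (D : {set 'I_p * 'I_p'}) :
  #|[set u in skeleton | f u \in D]| <= 51 * #|D|.
Proof.
apply: leq_trans (leq_card_bigcup (F := ports) _); last by move=> c _;
  apply: card_ports.
apply/subset_leq_card/subsetP => u; rewrite inE => /andP[+ uD].
by rewrite inE => /andP[_ up]; apply/bigcupP; exists (f u).
Qed.

Lemma skeleton_cell u : u \in W -> exists2 q, q \in skeleton & f q = f u.
Proof.
move=> uW; set q := odflt w0 [pick v in W | f v == f u].
have [qW fq] : q \in W /\ f q = f u.
  by rewrite /q; case: pickP => [v /andP[? /eqP]|/(_ u)] //; rewrite uW eqxx.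
by exists q => //; rewrite inE qW fq; apply/setU1P; left.
Qed.

Lemma skeleton_edge u v : u \in W -> v \in W -> G u v ->
  exists a b, [/\ a \in skeleton, b \in skeleton, f a = f u, f b = f v & G a b].
Proof.
move=> uW vW uv; have nuv := near_edge uv.
have [aW bW fa fb ab] : [/\ (link (f u) (f v)).1 \in W, (link (f u) (f v)).2 \in
  W,
    f (link (f u) (f v)).1 = f u, f (link (f u) (f v)).2 = f v &
    G (link (f u) (f v)).1 (link (f u) (f v)).2].
  rewrite /link; case: pickP => [e /and5P[? ? /eqP ? /eqP ? ?]|/(_ (u, v))] //.
  by rewrite /= uW vW !eqxx uv.
exists (link (f u) (f v)).1, (link (f u) (f v)).2; split=> //.
  rewrite inE aW fa; apply/setU1P; right; apply/setUP; left.
  by apply: imset_f; rewrite inE.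
rewrite inE bW fb; apply/setU1P; right; apply/setUP; right.
by apply/imsetP; exists (f u); rewrite ?inE // near_sym.
Qed.

Lemma skeleton_sub : skeleton \subset W.
Proof. by apply/subsetP=> u; rewrite inE => /andP[]. Qed.

Lemma skeleton_connected :
  exists2 rho, rho \in skeleton &
    forall q, q \in skeleton -> connect (induced G skeleton) q rho.
Proof.
have [rho rQ frho] := skeleton_cell w0W; exists rho => //.
have in_cell a b : a \in skeleton -> b \in skeleton -> f a = f b ->
    connect (induced G skeleton) a b.
  move=> aQ bQ /same_cell /orP[/eqP -> //|ab].
  by apply: connect1; rewrite /induced aQ bQ.
(* The claim is stated for every kept vertex in the cell of [u], so that a walk in [W] can be
   imitated cell by cell: across cells through the link, inside a cell through the clique. *)
suff main u : u \in W -> forall q, q \in skeleton -> f q = f u ->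
    connect (induced G skeleton) q rho.
  by move=> q qQ; apply: (main q) => //; apply: (subsetP skeleton_sub).
move=> uW; case/connectP: (connW uW) => s; elim: s u uW => [|v s IH] u uW /=.
  by move=> _ <- q qQ fq; apply: in_cell; rewrite ?fq.
case/andP=> /and3P[_ vW uv] ps ls q qQ fq.
have [a [b [aQ bQ fa fb ab]]] := skeleton_edge uW vW uv.
apply: connect_trans (in_cell q a qQ aQ _) _; first by rewrite fq.
apply: connect_trans (IH v vW ps ls b bQ fb); apply: connect1.
by rewrite /induced aQ bQ.
Qed.

End Ports.

(** * Strips, separating columns and the choice of the shift *)

Section Cells.
Variables (p p' : nat).
Implicit Types (c : 'I_p * 'I_p') (s r : nat).

Definition separating s r c : bool := (c.2 + r) %% s <= 1.

Definition cell_key s r c : nat :=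
  if separating s r c then 0 else ((c.2 + r) %/ s * p + c.1).+1.

(** Two adjacent separating columns lie between consecutive strips, so columns of different strips
    differ by at least 3. Near cells outside them therefore share a strip, and their keys differ as
    their rows do. *)
Lemma near_cell_key s r c c' : 0 < s -> near c c' ->
  ~~ separating s r c -> ~~ separating s r c' ->
  cell_key s r c <= cell_key s r c' + 2.
Proof.
move=> s0 /andP[/andP[n1 n2] /andP[n3 n4]] sc sc'.
rewrite /cell_key !ifN //; move: sc sc'; rewrite /separating -!ltnNge => m m'.
suff -> : (c.2 + r) %/ s = (c'.2 + r) %/ s by lia.
have := divn_eq (c.2 + r) s; have := divn_eq (c'.2 + r) s.
have := ltn_pmod (c.2 + r) s0; have := ltn_pmod (c'.2 + r) s0.
move: m m'; set q := _ %/ _; set q' := _ %/ _; set m := _ %% _; set m' := _ %% _.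
move=> mge m'ge m's ms E' E.
case: (ltngtP q q') => // lt; have := leq_mul lt (leqnn s); rewrite mulSn; lia.
Qed.

(** Averaging: each cell is separating for at most two of the [s] shifts, so the counts sum to at
    most [2 * s * s], and some shift has at most [2 * s]. *)
Lemma card_separating (C : {set 'I_p * 'I_p'})
    (s : nat) : 0 < s -> #|C| <= s * s ->
  exists2 r, r < s & #|[set c in C | separating s r c]| <= 2 * s.
Proof.
move=> s0 Cs.
have card_sum (T : finType) (A : {set T}) (P : pred T) :
    #|[set u in A | P u]| = \sum_(u in A) P u.
  rewrite -sum1_card big_mkcond [RHS]big_mkcond; apply: eq_bigr => u _.
  by rewrite inE; case: (u \in A); case: (P u).
have [/existsP[r hr]|/existsPn no] := boolP [exists r : 'I_s, #|[set c in C |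
  separating s r c]| <= 2 * s].
  by exists r.
have lo : \sum_(r < s) (2 * s).+1 <= \sum_(r < s) #|[set c in C | separating s r
  c]|.
  by apply: leq_sum => r _; rewrite ltnNge no.
have hi : \sum_(r < s) #|[set c in C | separating s r c]| <= \sum_(c in C) 2.
  rewrite (eq_bigr (fun r : 'I_s => \sum_(c in C) separating s r c)); last first.
    by move=> r _; rewrite (card_sum _ C (separating s r)).
  rewrite exchange_big; apply: leq_sum => c _ /=.
  have -> : \sum_(r < s) separating s r c = #|[set r : 'I_s in setT | separating
    s r c]|.
    rewrite (card_sum _ setT (fun r : 'I_s => separating s r c)).
    by apply: eq_bigl => r; rewrite inE.
  (* For a fixed column the residue, here 0 or 1, determines the shift. *)
  pose g (r : 'I_s) : 'I_2 := inord ((c.2 + r) %% s).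
  rewrite -(@card_in_imset _ _ g);
    first by rewrite -[X in _ <= X]card_ord max_card.
  move=> r r'; rewrite !inE /separating => h h' /(congr1 val);
    rewrite /= !inordK //.
  move/eqP; rewrite eqn_modDl !modn_small // => /eqP; exact: val_inj.
have := leq_trans lo hi; rewrite !sum_nat_const card_ord; nia.
Qed.

(** A cell of nonzero key is determined by its key, which has five possible values here, and by the
    residue of its shifted column. *)
Lemma card_window (s r i : nat) : 0 < s ->
  #|[set c | [&& 0 < cell_key s r c, cell_key s r c <= i + 2
     & i <= cell_key s r c + 2]]| <= 5 * s.
Proof.
move=> s0; pose g c : 'I_5 * 'I_s :=
  (inord (cell_key s r c + 2 - i), Ordinal (ltn_pmod (c.2 + r) s0)).
rewrite -(@card_in_imset _ _ g).
  by apply: leq_trans (max_card _) _; rewrite card_prod !card_ord.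
move=> c c'; rewrite !inE => h h' [] /(congr1 val) + Em; rewrite /= !inordK;
  try lia.
move=> Ek; have {Ek}Ek : cell_key s r c = cell_key s r c' by lia.
move: h h' Ek => /and3P[h _ _] /and3P[h' _ _].
move: h h'; rewrite /cell_key; case: ifP => // _ _; case: ifP => // _ _ [E].
have p0 : 0 < p by case: (c.1) => ? /=; apply: leq_ltn_trans.
have Ei : c.1 = c'.1.
  apply: val_inj; have := congr1 (modn^~ p) E; rewrite /= !modnMDl !modn_small //.
have Eq : (c.2 + r) %/ s = (c'.2 + r) %/ s.
  by have := congr1 (divn^~ p) E;
    rewrite /= !divnMDl // (divn_small (ltn_ord c.1)) (divn_small (ltn_ord c'.1))
    !addn0.
have Ej : c.2 = c'.2.
  apply: val_inj; apply: (@addIn r).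
  by rewrite (divn_eq (c.2 + r) s) (divn_eq (c'.2 + r) s) Eq Em.
by case: c c' Ei Ej {E Eq Em} => [? ?] [? ?] /= -> ->.
Qed.

End Cells.

Lemma solve_complete (n p p' : nat) (G : sgraph 'I_n) (R : {set 'I_n})
    (f : 'I_n -> 'I_p * 'I_p') (x : instance) :
  represents G R f x -> is_representation G f -> in_t x = #|R| ->
  steiner_tree_yes G R (in_k x) -> solve x.
Proof.
move=> xP fP tR /steiner_yesP[W [w0 w0W [connW RW kW]]].
have [[En Ep Ep'] _ _ Ef] := xP.
set s := width x.
have WN : #|W| <= budget x.
  rewrite /budget tR -(cardsID R W) leq_add //.
  by rewrite subset_leq_card // subsetIr.
have Ns : budget x <= s * s by apply: leq_ceil_sqrt.
have s0 : 0 < s.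
  rewrite lt0n; apply/eqP => s0; move: (leq_trans WN Ns).
  by rewrite s0 leqn0 cards_eq0 => /eqP W0; rewrite W0 inE in w0W.
have Cs : #|f @: W| <= s * s.
  by apply: leq_trans (leq_imset_card _ _) (leq_trans WN Ns).
have [r rs sepr] := card_separating s0 Cs.
have [rho rQ connQ] := skeleton_connected fP w0W connW.
set Q := skeleton G f W w0 in rQ connQ.
have QW : Q \subset W := skeleton_sub G f W w0.
have [d [d0 dP]] := depth_function (induced G Q) rho.
(* The default [u] keeps [par] inside [Q] even at the root. *)
pose par u := odflt u [pick y | induced G Q u y && (d u == (d y).+1)].
have parQ u : u \in Q -> par u \in Q.
  by move=> uQ; rewrite /par; case: pickP => //= y /andP[/and3P[]].
have parP u : u \in Q -> u != rho -> G u (par u) /\ d u = (d (par u)).+1.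
  move=> uQ ur; rewrite /par; case: pickP => [y /andP[/and3P[_ _ gy] /eqP]|] //=.
  have [_ [/eqP|[y [uy _ dy]]]] := dP u (connQ u uQ);
    first by rewrite (negbTE ur).
  by move/(_ y); rewrite uy dy eqxx.
have keyE (u : 'I_n) : key (x, (nat_of_ord rho, r)) u = cell_key s r (f u).
  by rewrite /key Ef Ep -/s edivmodE.
pose window i := [set c : 'I_p * 'I_p' | [&& 0 < cell_key s r c,
  cell_key s r c <= i + 2 & i <= cell_key s r c + 2]].
pose Q0 := [set u in Q | f u \in [set c in f @: W | separating s r c]].
have memQ0 u : u \in Q -> cell_key s r (f u) = 0 -> u \in Q0.
  move=> uQ; rewrite /cell_key; case: ifP => // sep _.
  apply/setIdP; split=> //; apply/setIdP; split=> //.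
  by apply: imset_f; apply: (subsetP QW).
(* The first two parts stay in every bag. The window holds the keys within 2 of [i], so the parent
   of a vertex with nonzero key [i] is in bag [i]: either it is in [Q0], or [near_cell_key]
   applies. *)
pose bag i := Q0 :|: par @: Q0 :|: [set u in Q | f u \in window i].
have inW i u : u \in Q -> cell_key s r (f u) <= i + 2 -> i <= cell_key s r (f u)
  + 2 ->
    u \in bag i.
  move=> uQ le ge; case: (posnP (cell_key s r (f u))) => [/memQ0|gt].
    by move=> /(_ uQ) u0; rewrite !in_setU u0.
  apply/setUP; right; apply/setIdP; split=> //; by rewrite inE gt le ge.
have bag_step i j u : u \in bag i ->
    (0 < cell_key s r (f u) -> i <= cell_key s r (f u) + 2 ->
       cell_key s r (f u) <= i + 2 ->
       cell_key s r (f u) <= j + 2 /\ j <= cell_key s r (f u) + 2) ->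
    u \in bag j.
  case/setUP=> [uX|/setIdP[uQ]] hj; first by apply/setUP; left.
  by move: hj; rewrite inE => /and3P[h1 h2 h3] /(_ h1 h3 h2)[]; apply: inW.
apply: (@sweep_solve n p p' G R f x xP rho r d par Q bag) => //.
- by move=> u /connQ /dP[]; rewrite card_ord.
- move=> u uQ ur; rewrite keyE.
  case: (posnP (cell_key s r (f u))) => [/(memQ0 _ uQ) u0|gt].
    by apply/setUP; left; apply/setUP; right; apply: imset_f.
  have [gp _] := parP u uQ ur; have pQ := parQ u uQ.
  case: (posnP (cell_key s r (f (par u)))) => [/(memQ0 _ pQ) u0|gt'].
    by rewrite !in_setU u0.
  have nsep v : 0 < cell_key s r (f v) -> ~~ separating s r (f v).
    by rewrite /cell_key; case: ifP.
  have nr := near_edge fP gp.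
  apply: inW => //; apply: near_cell_key => //; try exact: nsep.
  by rewrite near_sym.
- move=> u uR; have uW := subsetP RW u uR.
  have [q qQ fq] := skeleton_cell G f w0 uW; exists q => //.
  rewrite !keyE fq; split=> //; rewrite eq_sym; exact: (same_cell fP (esym fq)).
- move=> i; apply/subsetP => u /setUP[/setUP[|/imsetP[v + ->]]|].
  + by case/setIdP.
  + by case/setIdP=> /parQ.
  + by case/setIdP.
- by move=> u uQ; rewrite keyE; apply: inW; rewrite ?leq_addr.
- by move=> i u ui; rewrite keyE => lt; apply: bag_step ui _; lia.
- by move=> i u ui; rewrite keyE => lt; apply: bag_step ui _; lia.
- move=> i; rewrite /bag_size -/s.
  have c0 : #|Q0| <= 51 * (2 * s).
    by apply: leq_trans (card_skeleton G f w0W _) _; rewrite leq_mul2l sepr orbT.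
  have c1 : #|par @: Q0| <= #|Q0| by apply: leq_imset_card.
  have c2 : #|[set u in Q | f u \in window i]| <= 51 * (5 * s).
    by apply: leq_trans (card_skeleton G f w0W _) _;
      rewrite leq_mul2l card_window ?orbT.
  have -> : 459 * s = 51 * (2 * s) + 51 * (2 * s) + 51 * (5 * s) by lia.
  apply: leq_trans (leq_card_setU _ _) (leq_add _ c2).
  by apply: leq_trans (leq_card_setU _ _) (leq_add c0 (leq_trans c1 c0)).
- by apply: leq_trans kW; rewrite subset_leq_card // setSD.
Qed.

(** Truncating [k] is harmless because a tree has at most [n] vertices in all. *)
Lemma steiner_yes_minn (n : nat) (G : sgraph 'I_n) (R : {set 'I_n}) (k : nat) :
  steiner_tree_yes G R k <-> steiner_tree_yes G R (minn n k).
Proof.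
split=> -[W [F [h1 h2 h3 h4]]]; exists W, F; split=> //.
  by rewrite leq_min h4 andbT -[X in _ <= X]card_ord max_card.
by apply: leq_trans h4 (geq_minr _ _).
Qed.

(** * Running time *)

Section Encoding.
Variables (n p p' : nat) (G : sgraph 'I_n) (R : {set 'I_n}) (t k : nat).
Variables (f : 'I_n -> 'I_p * 'I_p').

Definition instance_of : instance :=
  (n, ([seq [seq G u v | v <- enum 'I_n] | u <- enum 'I_n],
  ([seq u \in R | u <- enum 'I_n], (t, (k, (p, (p',
  ([seq (nat_of_ord (f u).1, nat_of_ord (f u).2) | u <- enum 'I_n], tt)))))))).

Lemma enc_instance_of : enc_instance G R t k f = enc instance_of.
Proof.
rewrite /enc_instance /enc_graph /enc_set /enc_rep.
have -> : [seq enc_seq [seq enc_bool (G u v) | v <- enum 'I_n] | u <- enum 'I_n] =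
    [seq enc s | s <- [seq [seq G u v | v <- enum 'I_n] | u <- enum 'I_n]].
  by rewrite -map_comp; apply: eq_map => u;
    rewrite [RHS]/= /enc /Enc_seq -map_comp.
have -> : [seq enc_bool (u \in R) | u <- enum 'I_n] =
    [seq enc b | b <- [seq u \in R | u <- enum 'I_n]] by rewrite -map_comp.
have -> : [seq Node (enc_nat (f u).1) (enc_nat (f u).2) | u <- enum 'I_n] =
    [seq enc ij | ij <- [seq (nat_of_ord (f u).1, nat_of_ord (f u).2) | u <- enum
      'I_n]].
  by rewrite -map_comp.
by [].
Qed.

Lemma represents_capped : represents G R f (capped instance_of).
Proof.
have nth_enum (T : Type) (a : T) (g : 'I_n -> T) (u : 'I_n) :
    nth a [seq g v | v <- enum 'I_n] u = g u.
  by rewrite (nth_map u) ?nth_ord_enum // size_enum_ord.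
by split=> // *; rewrite /adjb /termb /in_adj /in_terms /in_rep /= !nth_enum.
Qed.

Lemma esize_map_le (A B : Type) {EB : Enc B} (b : nat) (g : A -> B) (s : seq A) :
  (forall a, esize (g a) <= b) -> esize [seq g a | a <- s] <= 2 + size s * b.
Proof.
move=> gb; elim: s => // a s IH; rewrite map_cons esize_cons /= mulSn.
by have := gb a; lia.
Qed.

Lemma esize_capped : t <= n -> p <= n -> p' <= n ->
  esize (capped instance_of) <= n.+2 ^ 7.
Proof.
move=> tn pn p'n; rewrite !esize_pair /= !esize_nat.
have c1 : esize [seq [seq G u v | v <- enum 'I_n] | u <- enum 'I_n] <= 2 + n * (2
  + n * 4).
  rewrite -[X in 2 + X * _]size_enum_ord; apply: esize_map_le => u.
  rewrite -[X in 2 + X * _]size_enum_ord; apply: esize_map_le => v;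
    exact: esize_bool.
have c2 : esize [seq u \in R | u <- enum 'I_n] <= 2 + n * 4.
  rewrite -[X in 2 + X * _]size_enum_ord; apply: esize_map_le => v;
    exact: esize_bool.
have c3 : esize [seq (nat_of_ord (f u).1, nat_of_ord (f u).2) | u <- enum 'I_n]
    <= 2 + n * (4 * n).
  rewrite -[X in 2 + X * _]size_enum_ord; apply: esize_map_le => v.
  rewrite esize_pair !esize_nat /=; have := ltn_ord (f v).1;
    have := ltn_ord (f v).2; lia.
have ct : esize tt = 2 by [].
rewrite ct /in_order /in_adj /in_terms /in_t /in_k /=.
have kn : minn n k <= n by apply: geq_minl.
(* The matrix makes the size quadratic in [n]; the constant [32 = 2 ^ 5] is absorbed by five more
   factors [n.+2]. *)
apply: (@leq_trans (32 * n.+2 ^ 2)).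
  by rewrite -mulnn; move: c1 c2 c3; set a := esize _; set b := esize _;
    set c := esize _; nia.
by rewrite (expnD _ 5 2) leq_mul2r (@leq_expl 5 2) ?orbT.
Qed.

End Encoding.

(** [459 * w + 1 <= 460 * w.+1] merges the exponents, and [51 = 20 + 1 + 30] collects the three
    summands. *)
Lemma time_bound (n w d m : nat) :
  m <= 20 * n.+1 + ((n.+2 ^ 7) ^ (459 * w).+1) ^ d + 30 ->
  m <= 51 * n.+2 ^ ((7 * 460 * d).+1 * w.+1).
Proof.
move=> le; apply: leq_trans le _; rewrite -!expnM.
set x := n.+2 ^ _; set y := n.+2 ^ _.
have xy : x <= y.
  by rewrite /x /y leq_pexp2l //; nia.
have ny : n.+2 <= y.
  by rewrite -{1}[n.+2]expn1 leq_pexp2l //; nia.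
lia.
Qed.

(** * From integer to real exponents *)

Import Order.TTheory GRing.Theory Num.Theory.

(** If the rounded root is [j.+1], then [j] is at most the real root and the remaining 2 is at most
    twice the real root. *)
Lemma ceil_sqrt_le_sqrt (K : realType) (m : nat) : 0 < m ->
  (((ceil_sqrt m).+1)%:R <= 3 * Num.sqrt (m%:R : K))%R.
Proof.
move=> m0; case E : (ceil_sqrt m) => [|j].
  by have := leq_ceil_sqrt m; rewrite E; lia.
have jm := ceil_sqrt_lt E.
have sqrt1 : (1 <= Num.sqrt (m%:R : K))%R.
  by rewrite -{1}[1%R]sqrtr1 ler_wsqrtr // ler1n.
have sqrtj : (j%:R <= Num.sqrt (m%:R : K))%R.
  rewrite -[X in (X <= _)%R]ger0_norm ?ler0n // -sqrtr_sqr ler_wsqrtr //.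
  by rewrite -natrX ler_nat -mulnn ltnW.
by rewrite -[j.+2]addn2 natrD; lra.
Qed.

Lemma leq_powR_sqrt (K : realType) (n N M D : nat) : 1 < n -> 0 < N -> N <= M ->
  ((n ^ (D * (ceil_sqrt N).+1))%:R <= n%:R `^ ((3 * D)%:R * Num.sqrt M%:R) :>
    K)%R.
Proof.
move=> n1 N0 NM; rewrite natrX -powR_mulrn ?ler0n //.
apply: ler_powR; first by rewrite ler1n ltnW.
rewrite natrM [(3 * D)%N]mulnC natrM -mulrA ler_wpM2l ?ler0n //.
apply: le_trans (ceil_sqrt_le_sqrt K N0) _.
by rewrite ler_wpM2l // ler_wsqrtr // ler_nat.
Qed.

Theorem lemma9 :
  exists (P : program) (c C : nat),
    forall (K : realType) (n : nat) (G : sgraph 'I_n) (R : {set 'I_n})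
           (t k p p' : nat) (f : 'I_n -> 'I_p * 'I_p'),
      #|R| = t -> 0 < k -> p <= n -> p' <= n -> is_representation G f ->
      exists (b : bool) (time : nat),
        [/\ runs P (enc_instance G R t k f) (enc_bool b) time,
            b <-> steiner_tree_yes G R k &
            ((time%:R : K) <=
               C%:R * (maxn n 1)%:R `^ (c%:R * Num.sqrt (t + k)%:R))%R].
Proof.
have [P [d solveP]] := program_solve.
pose D := (7 * 460 * d).+1.
(* In the exponent, 3 comes from [ceil_sqrt_le_sqrt] and 2 from [n.+2 <= n ^ 2] for [n >= 2]. The
   factor [3 ^ (3 * D)] covers [n <= 1], where [n.+2 <= 3] and [w.+1 <= 3]. *)
exists P, (3 * (2 * D)), (51 * 3 ^ (3 * D)) => K n G R t k p p' f Rt k0 pn p'n fP.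
pose x := instance_of G R t k f.
have [m mle run] := solveP x; exists (solve (capped x)), m.
have tn : t <= n by rewrite -Rt -[X in _ <= X](card_ord n) max_card.
have xP : represents G R f (capped x) by apply: represents_capped.
have kE : in_k (capped x) = minn n k by [].
split.
- by rewrite enc_instance_of.
- rewrite steiner_yes_minn -kE; split; last exact: (solve_complete xP fP).
  (* For [n = 0] the truncated budget is 0, so [solve_sound] does not apply; but then there is no
     candidate root and the search answers no. *)
  case: (posnP n) => [n0|n0]; last by apply: (solve_sound xP);
    rewrite kE leq_min n0.
  by move=> /hasP[rho]; rewrite (n0 : in_order (capped x) = 0).
set w := width (capped x).
have wE : w = ceil_sqrt (t + minn n k) by [].
have le : m <= 51 * n.+2 ^ (D * w.+1).
  apply: time_bound; apply: leq_trans mle _.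
  rewrite leq_add2r leq_add2l leq_expl // /search_cost leq_expl //.
  exact: esize_capped.
case: (leqP n 1) => n1.
  rewrite powR1 mulr1 ler_nat; apply: leq_trans le _; rewrite leq_mul2l /=.
  have w2 : w <= 2.
    rewrite wE; apply: leq_trans (count_size _ _) _; rewrite size_iota.
    by have := geq_minl n k; lia.
  apply: (@leq_trans (3 ^ (D * w.+1))); first by apply: leq_expl.
  by rewrite leq_pexp2l // mulnC leq_mul2r ltnS w2 orbT.
rewrite natrM -mulrA; apply: (@le_trans _ _ (51 * (n ^ (2 * D * w.+1))%:R)%R).
  rewrite -natrM ler_nat; apply: leq_trans le _;
    rewrite leq_mul2l /= -mulnA (expnM n 2).
  by apply: leq_expl; nia.
rewrite ler_wpM2l // -[X in (X <= _)%R]mul1r ler_pM ?ler0n //.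
  by rewrite ler1n expn_gt0.
apply: leq_powR_sqrt => //; rewrite ?leq_add2l ?geq_minr //.
by rewrite addn_gt0 leq_min k0 (ltnW n1) orbT.
Qed.
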